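(* For each $N$, let $p_{j,N}$, $j=1,\dots,N$, be the poles of the degree-$N$ best (minimax) rational approximant to $\sqrt{x}$ on $[0,1]$, ordered by increasing absolute value. For each fixed integer $k\ge 0$, $$p_{N-k,N} \sim -\frac{8N}{(2k+1)^2\pi^2}, \qquad N\to\infty.$$ In particular, the largest pole satisfies $p_{N,N}\sim -\frac{8N}{\pi^2}$.
   Context: The degree-$N$ best rational approximant is the rational function $p/q$ with $p,q$ polynomials of degree at most $N$ minimizing $\max_{x\in[0,1]}|\sqrt{x}-p(x)/q(x)|$; its poles lie on the negative real axis. *)

(* Defs.v *)
From HB Require Import structures.
From mathcomp Require Import all_boot all_order all_algebra.
From mathcomp Require Import all_classical all_reals all_analysis.
From mathcomp Require Import complex.
Set Implicit Arguments. Unset Strict Implicit. Unset Printing Implicit Defensive.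
Import Order.TTheory GRing.Theory Num.Theory.
Local Open Scope ring_scope.
Local Open Scope complex_scope.

Definition deg_le (R : realType) (N : nat) (p : {poly R}) : Prop :=
  (size p <= N.+1)%N.

Definition admissible (R : realType) (N : nat) (pq : {poly R} * {poly R}) : Prop :=
  deg_le N pq.1 /\ deg_le N pq.2 /\
  (forall x : R, 0 <= x <= 1 -> pq.2.[x] != 0).

Definition err_le (R : realType) (pq : {poly R} * {poly R}) (M : R) : Prop :=
  forall x : R, 0 <= x <= 1 -> `|Num.sqrt x - pq.1.[x] / pq.2.[x]| <= M.

(* (p, q) is (a lowest-terms representation of) the degree-N best rational
   approximant to sqrt on [0,1]: its sup-error is <= that of every
   admissible competitor. *)
Definition best_approx (R : realType) (N : nat) (pq : {poly R} * {poly R}) : Prop :=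
  admissible N pq /\ coprimep pq.1 pq.2 /\
  forall pq' : {poly R} * {poly R}, admissible N pq' ->
    forall M : R, err_le pq' M -> err_le pq M.

(* s is the list of complex roots of q (with multiplicity), i.e. of the
   poles of p/q when p, q are coprime. *)
Definition root_list (R : realType) (q : {poly R}) (s : seq R[i]) : Prop :=
  map_poly (real_complex R) q =
    (lead_coef q)%:C *: \prod_(z <- s) ('X - z%:P).

Definition sorted_by_abs (R : realType) (s : seq R[i]) : Prop :=
  sorted (fun a b : R[i] => `|a| <= `|b|) s.

(* Main.v *)
(** With [t = sqrt x] put [e(t) = t - p(t^2)/q(t^2)] and let [E] be the maximum
of [|e|] on [0, 1], [n = 2 N + 1]. A best approximant has an error alternating
[n + 1] times, so for each [c] in ]-1, 1[ the equation [e(t) = c E] has exactly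
[n] solutions [t_i(c)], all in [0, 1] and interlacing as [c] varies, and
[prod (z - t_i(c)) / (z + t_i(c)) = (e(z) - c E) / (2 z - e(z) + c E)].

On the imaginary axis this product has modulus one, and its argument shows that
the poles are [- 1 / v_k^2], where [sum_i atan (t_i(0) v_k) = (2 k + 1) pi / 2].
Hence, if [T = sum_i t_i(0)] is large, [v_k ~ (2 k + 1) pi / (2 T)], and it
remains to see that [T ~ sqrt (2 N)].

Since [|e| <= E], the logarithm of the product is [- ln (2 z / E)] on [0, 1] up
to a bounded error, on average over [c]. Integrating it against
[z / sqrt (al^2 - z^2)] on [0, al], whose potential is [pi t] for [t <= al] and
[pi (t - sqrt (t^2 - al^2))] beyond, gives
[pi sum_i jouk (t_i / al) = ln (al / E) + O(1)] uniformly for [al] in [E, 1].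
For [al = 1] this reads [pi T = L + O(1)] with [L = ln (1 / E)]. Integrating
over [al] with weight [1 / al], each [t_i] contributes [pi / 2] up to small
errors, so that [n pi^2 = L^2 + O(L)]. *)
Require Import Defs.
From HB Require Import structures.
From mathcomp Require Import all_boot all_order all_algebra.
From mathcomp Require Import all_classical all_reals all_analysis.
From mathcomp Require Import measurable_realfun.
From mathcomp Require Import complex.
From mathcomp Require Import ring lra zify.
Set Implicit Arguments. Unset Strict Implicit. Unset Printing Implicit Defensive.
Import Order.TTheory GRing.Theory Num.Theory.
Import numFieldNormedType.Exports.
Local Open Scope ring_scope.
Local Open Scope classical_set_scope.

(** * Derivative rules and monotonicity off a finite set *)

Section Calculus.
Context {R : realType}.
Implicit Types (f g : R -> R) (x a b df dg : R).

(** For fixed [k] the solution [v] of the pole equation is small, so [sum_i atan (t_i v)] is [T v]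
    to leading order. Only the linear statistic [T] matters, which is why the weight is chosen with
    a potential linear in [t] on [0, al]. Errors O(1) in [pi T = L + O(1)] and O(L) in
    [n pi^2 = L^2 + O(L)] suffice: [L] has order [sqrt N], so each costs a relative O(1 / sqrt N).

    The kernels have logarithmic singularities that move with the [t_i] and [al]. Apart from the
    Tonelli argument that selects the level [c], improper integrals are avoided: an integral
    inequality becomes a comparison of continuous primitives whose derivatives are compared off a
    finite set.

    Alternation is derived, not assumed: if the extremal points could be separated by a polynomial
    of too small degree, perturbing [p] and [q] along it would improve the approximant. With [D] the
    larger degree of [p] and [q], this yields [N + D + 1] alternation intervals; the numerator of
    the error has degree at most [2 D + 1] in [t], which forces [D = N]. *)

Lemma within_continuous_itv f a b :
  (forall x, a <= x <= b -> {for x, continuous f}) ->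
  {within `[a, b], continuous f}.
Proof.
by move=> h; apply: continuous_in_subspaceT => x /[!inE]/=; rewrite in_itv/= => /h.
Qed.

(** The substitute for monotonicity of the integral: the mean value theorem applies between
    consecutive points of [Z], and continuity glues the pieces. The points of [Z] will be
    logarithmic singularities. *)
Lemma le_derive_off_finite (Z : seq R) f (df : R -> R) a b : a <= b ->
  {within `[a, b], continuous f} ->
  (forall x, a < x < b -> x \notin Z -> is_derive x 1 f (df x)) ->
  (forall x, a < x < b -> x \notin Z -> 0 <= df x) ->
  f a <= f b.
Proof.
elim: Z a b => [|z Z IH] a b; rewrite le_eqVlt => /predU1P[-> //|ab] cf dfE df0.
- have h : forall x, x \in `]a, b[%R -> is_derive x 1 f (df x).
    by move=> x; rewrite in_itv/= => /dfE; apply.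
  have [c ci e] := MVT ab h cf.
  move: ci; rewrite in_itv/= => ci.
  by rewrite -subr_ge0 e mulr_ge0 ?subr_ge0 ?(ltW ab) ?df0.
- have [/andP[az zb]|zo] := boolP (a < z < b); last first.
    apply: IH => //; first exact: ltW.
    + move=> x xi xZ; apply: dfE => //; rewrite inE negb_or xZ andbT.
      by apply: contraNneq zo => <-.
    + move=> x xi xZ; apply: df0 => //; rewrite inE negb_or xZ andbT.
      by apply: contraNneq zo => <-.
  apply: (@le_trans _ _ (f z)); apply: IH; rewrite ?ltW//.
  + apply: continuous_subspaceW cf => y /=; rewrite !in_itv/= => /andP[-> yz] /=.
    by rewrite (le_trans yz) ?ltW.
  + move=> x /andP[ax xz] xZ; apply: dfE; first by rewrite ax (lt_trans xz).
    by rewrite inE negb_or xZ lt_eqF.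
  + move=> x /andP[ax xz] xZ; apply: df0; first by rewrite ax (lt_trans xz).
    by rewrite inE negb_or xZ lt_eqF.
  + apply: continuous_subspaceW cf => y /=; rewrite !in_itv/= => /andP[zy ->] /=.
    by rewrite andbT (le_trans _ zy) ?ltW.
  + move=> x /andP[zx xb] xZ; apply: dfE; first by rewrite xb (lt_trans az).
    by rewrite inE negb_or xZ gt_eqF.
  + move=> x /andP[zx xb] xZ; apply: df0; first by rewrite xb (lt_trans az).
    by rewrite inE negb_or xZ gt_eqF.
Qed.

Lemma is_derive1D f g x df dg : is_derive x 1 f df -> is_derive x 1 g dg ->
  is_derive x 1 (fun y => f y + g y) (df + dg).
Proof. by move=> *; exact: is_deriveD. Qed.

Lemma is_derive1B f g x df dg : is_derive x 1 f df -> is_derive x 1 g dg ->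
  is_derive x 1 (fun y => f y - g y) (df - dg).
Proof. by move=> *; exact: is_deriveB. Qed.

Lemma is_derive1M f g x df dg : is_derive x 1 f df -> is_derive x 1 g dg ->
  is_derive x 1 (fun y => f y * g y) (f x * dg + g x * df).
Proof. by move=> *; exact: is_deriveM. Qed.

Lemma is_derive1_const (c : R) x : is_derive x 1 (fun _ : R => c) 0.
Proof. exact: is_derive_cst. Qed.

Lemma is_derive1_id x : is_derive x 1 (fun y : R => y) 1.
Proof. exact: is_derive_id. Qed.

Lemma is_derive1_chain f g x df dg : is_derive (f x) 1 g dg ->
  is_derive x 1 f df -> is_derive x 1 (fun y => g (f y)) (dg * df).
Proof. by move=> hg hf; exact: is_derive1_comp. Qed.

Lemma is_derive1V f x df : is_derive x 1 f df -> f x != 0 ->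
  is_derive x 1 (fun y => (f y)^-1) (- df / f x ^+ 2).
Proof.
move=> hf fx; have := is_deriveV fx hf; rewrite /GRing.scale/= => h.
by apply: is_derive_eq h _; rewrite mulNr mulNr mulrC.
Qed.

Lemma is_derive1_div f g x df dg : is_derive x 1 f df ->
  is_derive x 1 g dg -> g x != 0 ->
  is_derive x 1 (fun y => f y / g y) ((df * g x - f x * dg) / g x ^+ 2).
Proof.
move=> hf hg gx; apply: (is_derive_eq (is_derive1M hf (is_derive1V hg gx))).
by field.
Qed.

Lemma is_derive1_Zl (c : R) f x df : is_derive x 1 f df ->
  is_derive x 1 (fun y => c * f y) (c * df).
Proof.
move=> hf; apply: (is_derive_eq (is_derive1M (is_derive1_const c x) hf)).
by rewrite mulr0 addr0.
Qed.

Lemma is_derive1_sqr f x df : is_derive x 1 f df ->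
  is_derive x 1 (fun y => f y ^+ 2) (2 * f x * df).
Proof.
move=> hf; apply: (is_derive_eq (is_derive1M hf hf)).
ring.
Qed.

Lemma is_derive1_sqrt f x df : is_derive x 1 f df -> 0 < f x ->
  is_derive x 1 (fun y => Num.sqrt (f y)) (df / (2 * Num.sqrt (f x))).
Proof.
move=> hf fx; rewrite mulrC.
exact: is_derive1_chain (realfun.is_derive1_sqrt fx) hf.
Qed.

Lemma is_derive1_lnabs f x df : is_derive x 1 f df -> f x != 0 ->
  is_derive x 1 (fun y => ln `|f y|) (df / f x).
Proof.
move=> hf fx.
have h : is_derive (f x) 1 (fun y : R => ln `|y|) (f x)^-1.
  move: fx; rewrite neq_lt => /orP[fx|fx].
  - apply: (near_eq_is_derive (f := fun y => ln (- y))).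

    + near=> y; rewrite ltr0_norm//; near: y; exact: lt_nbhsl.
    + have nx : 0 < - f x by rewrite oppr_gt0.
      apply: (is_derive_eq (is_derive1_chain (is_derive1_ln nx) (is_deriveNid _ _))).
      by rewrite invrN mulrNN mulr1.
  - apply: (near_eq_is_derive (f := fun y => ln y)).

    + near=> y; rewrite gtr0_norm//; near: y; exact: lt_nbhsr.
    + exact: is_derive1_ln.
by rewrite mulrC; apply: is_derive1_chain hf.
Unshelve. all: by end_near. Qed.

Lemma is_derive1_sum (n : nat) (F : 'I_n -> R -> R) (dF : 'I_n -> R) x :
  (forall i, is_derive x 1 (F i) (dF i)) ->
  is_derive x 1 (fun y => \sum_(i < n) F i y) (\sum_(i < n) dF i).
Proof.
move=> h; have := is_derive_sum h.
by congr is_derive; apply/funext => y; rewrite fct_sumE.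
Qed.

Lemma is_derive_continuous f x df : is_derive x 1 f df -> {for x, continuous f}.
Proof.
by move=> h; apply: differentiable_continuous; apply/derivable1_diffP; apply: ex_derive.
Qed.

(** This is [ln u <= u] at [u = 1 / sqrt |x|]. It makes [x ln |x|] continuous at 0, so that
    primitives of logarithmic kernels can cross their singularities. *)
Lemma norm_xln_le x : `|x| <= 1 -> `|x * ln `|x| | <= 2 * Num.sqrt `|x|.
Proof.
move=> x1; have [->|x0] := eqVneq x 0; first by rewrite mul0r normr0 sqrtr0 mulr0.
have xp : 0 < `|x| by rewrite normr_gt0.
have sp : 0 < Num.sqrt `|x| by rewrite sqrtr_gt0.
rewrite normrM (ler0_norm (ln_le0 x1)).
have -> : ln `|x| = - (ln (Num.sqrt `|x|)^-1 *+ 2).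
  by rewrite lnV ?posrE// mulNrn opprK -lnXn// sqr_sqrtr// ltW.
rewrite opprK -{1}(sqr_sqrtr (ltW xp)).
have h : Num.sqrt `|x| * ln (Num.sqrt `|x|)^-1 <= 1.
  by rewrite -ler_pdivlMl// mulr1 ltW// ln_sublinear// invr_gt0.
have := ler_wpM2l (ltW sp) h; lra.
Qed.

Lemma continuous_xln : continuous (fun x : R => x * ln `|x|).
Proof.
move=> x; have [->|x0] := eqVneq x 0; last first.
  have := is_derive1M (is_derive1_id x) (is_derive1_lnabs (is_derive1_id x) x0).
  exact: is_derive_continuous.
apply/cvgrPdist_le => e e0; rewrite mul0r.
have e2 : 0 < Num.min 1 ((e / 2) ^+ 2) by rewrite lt_min ltr01 exprn_gt0// divr_gt0.
exists (Num.min 1 ((e / 2) ^+ 2)) => //= y; rewrite /ball_/= !sub0r !normrN.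
rewrite lt_min => /andP[y1 ye].
apply: le_trans (norm_xln_le (ltW y1)) _.
rewrite -ler_pdivlMl// mulrC -[leRHS](@ger0_norm _ (e / 2)) ?divr_ge0 ?ltW//.
by rewrite -(sqrtr_sqr (e / 2)) ltr_sqrt// exprn_gt0// divr_gt0.
Qed.

End Calculus.

(** * The logarithmic kernel and its primitive against the arcsine-type weight *)

Section Kernel.
Context {R : realType}.
Implicit Types (f g : R -> R) (x y s t : R).

Lemma cont_ext f g x : f =1 g -> {for x, continuous f} -> {for x, continuous g}.
Proof. by move=> /funext ->. Qed.

Lemma contD f g x : {for x, continuous f} -> {for x, continuous g} ->
  {for x, continuous (fun y => f y + g y)}.
Proof. by move=> hf hg; exact: cvgD. Qed.

Lemma contB f g x : {for x, continuous f} -> {for x, continuous g} ->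
  {for x, continuous (fun y => f y - g y)}.
Proof. by move=> hf hg; exact: cvgB. Qed.

Lemma contM f g x : {for x, continuous f} -> {for x, continuous g} ->
  {for x, continuous (fun y => f y * g y)}.
Proof. by move=> hf hg; exact: cvgM. Qed.

Lemma contZ (c : R) g x : {for x, continuous g} ->
  {for x, continuous (fun y => c * g y)}.
Proof. by move=> hg; apply: contM => //; exact: cvg_cst. Qed.

Lemma cont_comp f g x : {for x, continuous f} -> {for f x, continuous g} ->
  {for x, continuous (fun y => g (f y))}.
Proof. exact: continuous_comp. Qed.

Lemma cont_div f g x : g x != 0 -> {for x, continuous f} -> {for x, continuous g} ->
  {for x, continuous (fun y => f y / g y)}.
Proof. by move=> g0 hf hg; apply: contM => //; exact: cvgV. Qed.

Lemma cont_lnabs f x : f x != 0 -> {for x, continuous f} ->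
  {for x, continuous (fun y => ln `|f y|)}.
Proof.
move=> f0 hf; apply: (cont_comp hf (g := fun y => ln `|y|)).
exact: is_derive_continuous (is_derive1_lnabs (is_derive1_id _) f0).
Qed.

Lemma cont_cst (c : R) x : {for x, continuous (fun _ : R => c)}.
Proof. exact: cvg_cst. Qed.

Lemma cont_sum (n : nat) (F : 'I_n -> R -> R) x :
  (forall i, {for x, continuous (F i)}) ->
  {for x, continuous (fun y => \sum_(i < n) F i y)}.
Proof.
move=> h; rewrite -fct_sumE; elim/big_rec: _ => [|i f _ cf]; last exact: contD.
exact: cont_cst.
Qed.

Lemma cont_id x : {for x, continuous (fun y : R => y)}.
Proof. exact: cvg_id. Qed.

Lemma cont_sqrt f x : {for x, continuous f} ->
  {for x, continuous (fun y => Num.sqrt (f y))}.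
Proof. by move=> hf; apply: (cont_comp hf); exact: sqrt_continuous. Qed.

(* [asin] on [-1, 1]; unlike [asin], this expression is manifestly continuous at
   the endpoints. *)
Definition asinc y : R := 2 * atan (y / (1 + Num.sqrt (1 - y ^+ 2))).

Lemma asinc0 : asinc 0 = 0.
Proof. by rewrite /asinc mul0r atan0 mulr0. Qed.

Lemma asinc1 : asinc 1 = pi / 2.
Proof. by rewrite /asinc expr1n subrr sqrtr0 addr0 divr1 atan1; field. Qed.

Lemma continuous_asinc : continuous asinc.
Proof.
move=> x; apply: contZ; apply: (@cont_comp (fun y => y / (1 + Num.sqrt (1 - y ^+ 2)))).
  apply: cont_div; first by rewrite gt_eqF// ltr_pwDl// sqrtr_ge0.
    exact: cont_id.
  apply: contD; first exact: cont_cst.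
  by apply: cont_sqrt; apply: contB; [exact: cont_cst|exact: exprn_continuous].
exact: continuous_atan.
Qed.

Lemma is_derive1_semicircle y : -1 < y < 1 ->
  is_derive y 1 (fun y => Num.sqrt (1 - y ^+ 2)) (- y / Num.sqrt (1 - y ^+ 2)).
Proof.
move=> y1; have p : 0 < 1 - y ^+ 2 by nra.
have h := is_derive1B (is_derive1_const 1 y) (is_derive1_sqr (is_derive1_id y)).
apply: (is_derive_eq (is_derive1_sqrt h p)).
by field; rewrite gt_eqF// sqrtr_gt0.
Qed.

Lemma is_derive1_asinc f x df : is_derive x 1 f df -> -1 < f x < 1 ->
  is_derive x 1 (fun y => asinc (f y)) (df / Num.sqrt (1 - f x ^+ 2)).
Proof.
move=> hf f1; rewrite mulrC; apply: is_derive1_chain hf.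
move: (f x) f1 => {f df}y y1.
have p : 0 < 1 - y ^+ 2 by nra.
set t := Num.sqrt (1 - y ^+ 2).
have tp : 0 < t by rewrite sqrtr_gt0.
have t2 : t ^+ 2 = 1 - y ^+ 2 by rewrite sqr_sqrtr// ltW.
have n1 : 1 + t != 0 by rewrite gt_eqF// addr_gt0.
have h1 := is_derive1D (is_derive1_const 1 y) (is_derive1_semicircle y1).
have h2 := is_derive1_div (is_derive1_id y) h1 n1.
have h3 := is_derive1_chain (is_derive1_atan _) h2.
apply: (is_derive_eq (is_derive1_Zl 2 h3)); rewrite -/t.
have -> : 1 + (y / (1 + t)) ^+ 2 = 2 / (1 + t).
  by rewrite expr_div_n; apply/eqP; rewrite -subr_eq0; apply/eqP; field: t2.
by field: t2; rewrite n1 gt_eqF.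
Qed.
(** The Green function of the right half-plane; summed over zeros it is minus the logarithm of the
    modulus of their Blaschke product. *)
Definition lnker (t s : R) : R := ln `|t + s| - ln `|t - s|.

Lemma continuous_semicircle : continuous (fun y : R => Num.sqrt (1 - y ^+ 2)).
Proof.
move=> y; apply: (@cont_sqrt (fun y => 1 - y ^+ 2)).
by apply: contB; [exact: cont_cst|exact: exprn_continuous].
Qed.

(** With [t = sqrt (1 - y^2)] and [u = sqrt (1 - s^2)], the identity [t^2 - s^2 = u^2 - y^2] moves
    the singularity of [ln |t - s|] to [y = u], where it is integrated explicitly as
    [(y - u) ln |y - u|]. *)
Lemma lnker_primitive_le1 s : 0 < s <= 1 -> exists H : R -> R,
  [/\ forall y, 0 <= y <= 1 -> {for y, continuous H}, H 0 = 0, H 1 = pi * s &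
   forall y, 0 < y < 1 -> Num.sqrt (1 - y ^+ 2) != s ->
     is_derive y 1 H (lnker (Num.sqrt (1 - y ^+ 2)) s)].
Proof.
move=> /andP[s0 s1].
pose T := fun y : R => Num.sqrt (1 - y ^+ 2).
pose u := Num.sqrt (1 - s ^+ 2).
have u0 : 0 <= u by exact: sqrtr_ge0.
have u2 : u ^+ 2 = 1 - s ^+ 2 by rewrite sqr_sqrtr//; nra.
have Tge0 y : 0 <= T y by exact: sqrtr_ge0.
have T2 y : 0 <= y <= 1 -> T y ^+ 2 = 1 - y ^+ 2 by move=> ?; rewrite sqr_sqrtr//; nra.
pose H := fun y : R => 2 * (y * ln `|T y + s|) - 2 * (u * ln `|u * T y + s * y|)
   + 2 * (s * asinc y) - (y - u) * ln `|y - u| - (y - u) * ln `|y + u|.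
have cT y : {for y, continuous T} by exact: continuous_semicircle.
have cxln (c y : R) : {for y, continuous (fun y => (y - c) * ln `|y - c|)}.
  apply: (@cont_comp (fun y => y - c) (fun x => x * ln `|x|)).
    by apply: contB; [exact: cont_id|exact: cont_cst].
  exact: continuous_xln.
exists H; split.
- move=> y y01; apply: contB; [apply: contB; [apply: contD; [apply: contB|]|]|].
  + apply: contZ; apply: contM; first exact: cont_id.
    apply: cont_lnabs; first by rewrite gt_eqF// ltr_wpDl.
    by apply: contD => //; exact: cont_cst.
  (* For [u = 0], that is [s = 1], the argument of the logarithm vanishes at [y = 0], but the factor
     [u] kills the whole term. *)
  + apply: contZ; have [u0'|un0] := eqVneq u 0.
      by apply: (cont_ext _ (@cont_cst 0 y)) => z; rewrite u0' mul0r.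
    have up : 0 < u by rewrite lt_neqAle eq_sym un0.
    apply: contZ; apply: cont_lnabs.
      have [y0|yp] := eqVneq y 0.
        by rewrite y0 mulr0 addr0 mulf_neq0// gt_eqF// /T expr0n/= subr0 sqrtr1.
      by rewrite gt_eqF// ltr_wpDl// ?mulr_ge0// mulr_gt0// lt_neqAle eq_sym yp; case/andP: y01.
    by apply: contD; apply: contZ => //; exact: cont_id.
  + by apply: contZ; apply: contZ; exact: continuous_asinc.
  + exact: cxln.
  + have [u0'|un0] := eqVneq u 0.
      by apply: (cont_ext _ (cxln 0 y)) => z; rewrite u0' addr0 subr0.
    apply: contM; first by apply: contB; [exact: cont_id|exact: cont_cst].
    apply: cont_lnabs.
      by rewrite gt_eqF// ltr_wpDl//; [case/andP: y01|rewrite lt_neqAle eq_sym un0].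
    by apply: contD; [exact: cont_id|exact: cont_cst].
- rewrite /H asinc0 /T expr0n/= subr0 sqrtr1 !mulr0 !mulr1 !mul0r mulr0 !sub0r !addr0 !add0r normrN.
  by ring.
- rewrite /H asinc1 /T expr1n subrr sqrtr0 !mulr0 !mulr1 !add0r !mul1r.
  rewrite (gtr0_norm s0).
  have [u0'|un0] := eqVneq u 0.
    have -> : s = 1 by nra.
    by rewrite u0' subr0 addr0 normr1 ln1; field.
  have u1 : u < 1 by nra.
  rewrite (@gtr0_norm _ (1 - u)) ?subr_gt0// (@gtr0_norm _ (1 + u)) ?ltr_wpDr//.
  have e : ln (1 - u) + ln (1 + u) = 2 * ln s.
    rewrite -lnM ?posrE ?subr_gt0 ?ltr_wpDr// mulr_natl -lnXn//; congr ln.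
    by rewrite -[RHS](subKr 1) -u2; ring.
  have -> : ln s = (ln (1 - u) + ln (1 + u)) / 2 by rewrite e; field.
  by field.
- move=> y /andP[y0 y1] Ts; rewrite -/(T y) in Ts *.
  have y11 : -1 < y < 1 by rewrite y1 andbT (lt_trans _ y0)// ltrN10.
  have y01 : 0 <= y <= 1 by rewrite !ltW.
  have tp : 0 < T y by rewrite sqrtr_gt0; nra.
  have t2 := T2 y y01.
  have dT := is_derive1_semicircle y11; rewrite -/T -/(T y) in dT.
  have yu : y - u != 0.
    apply: contra_neq Ts => /eqP; rewrite subr_eq0 => /eqP yu.
    by rewrite /T yu u2 subKr sqrtr_sqr gtr0_norm.
  have Ts0 : T y + s != 0 by rewrite gt_eqF// addr_gt0.
  have uTs0 : u * T y + s * y != 0.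
    by rewrite gt_eqF// ltr_wpDl// ?mulr_ge0 ?mulr_gt0.
  have yu0 : y + u != 0 by rewrite gt_eqF// ltr_wpDr.
  have i := is_derive1_id y; have k c := is_derive1_const c y.
  have d1 := is_derive1_Zl 2 (is_derive1M i (is_derive1_lnabs (is_derive1D dT (k s)) Ts0)).
  have d2 := is_derive1_Zl 2 (is_derive1_Zl u
    (is_derive1_lnabs (is_derive1D (is_derive1_Zl u dT) (is_derive1_Zl s i)) uTs0)).
  have d3 := is_derive1_Zl 2 (is_derive1_Zl s (is_derive1_asinc i y11)).
  have d4 := is_derive1M (is_derive1B i (k u)) (is_derive1_lnabs (is_derive1B i (k u)) yu).
  have d5 := is_derive1M (is_derive1B i (k u)) (is_derive1_lnabs (is_derive1D i (k u)) yu0).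
  apply: (is_derive_eq (is_derive1B (is_derive1B (is_derive1D (is_derive1B d1 d2) d3) d4) d5)).
  rewrite -/(T y) /lnker; move: (T y) tp t2 Ts Ts0 uTs0 {d1 d2 d3 d4 d5 dT} => t tp t2 ts Ts0 uTs0.
  have lt : ln `|t - s| = ln `|y - u| + ln `|y + u| - ln `|t + s|.
    have ts' : t - s != 0 by rewrite subr_eq0.
    apply/eqP; rewrite eq_sym subr_eq -!lnM ?posrE ?normr_gt0// -!normrM; apply/eqP.
    congr ln; rewrite -normrN; congr `| _ |.
    by ring: t2 u2.
  rewrite lt.
  have D0 : t ^+ 2 + y ^+ 2 - s ^+ 2 - u ^+ 2 = 0 by rewrite t2 u2; ring.
  apply/eqP; rewrite -subr_eq0; apply/eqP.
  (* The two sides differ by a multiple of this polynomial, which vanishes because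
     [t^2 + y^2 = 1 = s^2 + u^2]. *)
  transitivity ((t ^+ 2 + y ^+ 2 - s ^+ 2 - u ^+ 2) *
    (- 2 / (t * (t + s)) + 2 * u ^+ 2 / ((y + u) * (t + s) * (u * t + s * y)))).
    2: by rewrite D0 mul0r.
  by field; rewrite Ts0 uTs0 yu yu0 gt_eqF.
Qed.
(** No singularity is met, since [T y <= 1 < s]. Now [1 - s^2 = - k^2] is negative, and the
    logarithmic term with factor [u] turns into an arcsine with factor [k]; at [y = 1] its argument
    is 1, whence the contribution [- pi k]. *)
Lemma lnker_primitive_gt1 s : 1 < s -> exists H : R -> R,
  [/\ forall y, 0 <= y <= 1 -> {for y, continuous H}, H 0 = 0,
   H 1 = pi * (s - Num.sqrt (s ^+ 2 - 1)) &
   forall y, 0 < y < 1 ->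
     is_derive y 1 H (lnker (Num.sqrt (1 - y ^+ 2)) s)].
Proof.
move=> s1.
pose T := fun y : R => Num.sqrt (1 - y ^+ 2).
set k := Num.sqrt (s ^+ 2 - 1).
have kp : 0 < k by rewrite sqrtr_gt0; nra.
have k2 : k ^+ 2 = s ^+ 2 - 1 by rewrite sqr_sqrtr//; nra.
have sp : 0 < s by lra.
have Tge0 y : 0 <= T y by exact: sqrtr_ge0.
have T1 y : T y <= 1.
  by rewrite -[leRHS]sqrtr1 ler_sqrt// lerBlDr lerDl sqr_ge0.
have T2 y : 0 <= y <= 1 -> T y ^+ 2 = 1 - y ^+ 2 by move=> ?; rewrite sqr_sqrtr//; nra.
have cT y : {for y, continuous T} by exact: continuous_semicircle.
pose r := fun y : R => Num.sqrt (k ^+ 2 + y ^+ 2).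
have rp y : 0 < r y by rewrite sqrtr_gt0; have := exprn_gt0 2 kp; have := sqr_ge0 y; lra.
have r2 y : r y ^+ 2 = k ^+ 2 + y ^+ 2 by rewrite sqr_sqrtr// addr_ge0// sqr_ge0.
pose H := fun y : R => y * (ln `|T y + s| - ln `|T y - s|) + 2 * (s * asinc y)
  - 2 * (k * asinc (s * y / r y)).
have Ts0 y : T y + s != 0 by rewrite gt_eqF// ltr_wpDl.
have Tms0 y : T y - s != 0 by rewrite lt_eqF// subr_lt0 (le_lt_trans (T1 y)).
exists H; split.
- move=> y y01; apply: contB; [apply: contD|].
  + apply: contM; first exact: cont_id.
    by apply: contB; apply: cont_lnabs => //; [apply: contD|apply: contB] => //; exact: cont_cst.
  + by apply: contZ; apply: contZ; exact: continuous_asinc.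
  + do 2!apply: contZ; apply: (@cont_comp (fun y => s * y / r y)); last exact: continuous_asinc.
    apply: cont_div; first by rewrite gt_eqF.
      by apply: contZ; exact: cont_id.
    apply: cont_sqrt; apply: contD; first exact: cont_cst.
    exact: exprn_continuous.
- by rewrite /H asinc0 mulr0 !mul0r asinc0 !mulr0 subr0 addr0.
- rewrite /H asinc1 /T /r expr1n subrr sqrtr0 add0r sub0r normrN.
  have -> : k ^+ 2 + 1 = s ^+ 2 by rewrite k2; ring.
  rewrite sqrtr_sqr gtr0_norm// mulr1 divff ?gt_eqF// asinc1.
  by field.
- move=> y /andP[y0 y1]; rewrite -/(T y).
  have y11 : -1 < y < 1 by rewrite y1 andbT (lt_trans _ y0)// ltrN10.
  have y01 : 0 <= y <= 1 by rewrite !ltW.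
  have tp : 0 < T y by rewrite sqrtr_gt0; nra.
  have t2 := T2 y y01.
  have dT := is_derive1_semicircle y11; rewrite -/T -/(T y) in dT.
  have i := is_derive1_id y; have cst c := is_derive1_const c y.
  have q0 : 0 < k ^+ 2 + y ^+ 2 by rewrite -r2 exprn_gt0.
  have dr := is_derive1_sqrt (is_derive1D (cst (k ^+ 2)) (is_derive1_sqr i)) q0.
  rewrite -/r -/(r y) in dr.
  have rn0 : r y != 0 by rewrite gt_eqF.
  have dw := is_derive1_div (is_derive1_Zl s i) dr rn0.
  have w2 : 1 - (s * y / r y) ^+ 2 = (k * T y / r y) ^+ 2.
    have e := r2 y; rewrite !expr_div_n !exprMn t2 e.
    by field: k2; rewrite gt_eqF.
  have w1 : -1 < s * y / r y < 1.
    have := exprn_gt0 2 (divr_gt0 (mulr_gt0 kp tp) (rp y)); rewrite -w2.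
    by have := divr_gt0 (mulr_gt0 sp y0) (rp y); nra.
  have d1 := is_derive1M i (is_derive1B
    (is_derive1_lnabs (is_derive1D dT (cst s)) (Ts0 y))
    (is_derive1_lnabs (is_derive1B dT (cst s)) (Tms0 y))).
  have d2 := is_derive1_Zl 2 (is_derive1_Zl s (is_derive1_asinc i y11)).
  have d3 := is_derive1_Zl 2 (is_derive1_Zl k (is_derive1_asinc dw w1)).
  apply: (is_derive_eq (is_derive1B (is_derive1D d1 d2) d3)).
  rewrite w2 sqrtr_sqr -/(T y) (@ger0_norm _ (k * T y / r y)).
    2: by rewrite divr_ge0 ?mulr_ge0 ?ltW.
  have e := r2 y; have := rp y; have := Ts0 y; have := Tms0 y; rewrite /lnker.
  move: (T y) (r y) tp t2 rn0 e {d1 d2 d3 dT dr dw w1 w2} => t q tp t2 qn0 e tms tps qp.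
  have kn : k != 0 by rewrite gt_eqF.
  have tn : t != 0 by rewrite gt_eqF.
  have E1 : (- y / t + 0) / (t + s) - (- y / t - 0) / (t - s) = - 2 * s * y / (t * q ^+ 2).
    have -> : (- y / t + 0) / (t + s) - (- y / t - 0) / (t - s) =
        2 * s * y / (t * ((t + s) * (t - s))).
      by field; rewrite tn tms tps.
    have -> : (t + s) * (t - s) = - q ^+ 2 by ring: t2 e k2.
    by field; rewrite tn qn0.
  rewrite E1.
  have qy : q ^+ 2 - y ^+ 2 = k ^+ 2 by rewrite e addrK.
  have -> : (s * 1 * q - s * y * ((0 + 2 * y * 1) / (2 * q))) / q ^+ 2 / (k * t / q) =
      s * k / (t * q ^+ 2).
    have -> : (s * 1 * q - s * y * ((0 + 2 * y * 1) / (2 * q))) =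
        s * (q ^+ 2 - y ^+ 2) / q by field.
    by rewrite qy; field; rewrite qn0 tn kn.
  have -> : 2 * (k * (s * k / (t * q ^+ 2))) = 2 * s * (q ^+ 2 - y ^+ 2) / (t * q ^+ 2).
    by rewrite qy; field; rewrite qn0 tn.
  by field; rewrite qn0 tn.
Qed.

(* With [z = sqrt (1 - y ^ 2)], the integral over [y] in [0, 1] is that of
   [ln |(z + s) / (z - s)|] against the weight [z / sqrt (1 - z ^ 2)]; its value
   is [pi * s] for [s <= 1], which inverts the kernel on linear functions. *)
Lemma lnker_primitive s : 0 < s -> exists H : R -> R,
  [/\ forall y, 0 <= y <= 1 -> {for y, continuous H}, H 0 = 0,
   H 1 = pi * (s - Num.sqrt (s ^+ 2 - 1)) &
   forall y, 0 < y < 1 -> Num.sqrt (1 - y ^+ 2) != s ->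
     is_derive y 1 H (lnker (Num.sqrt (1 - y ^+ 2)) s)].
Proof.
move=> s0; have [s1|s1] := leP s 1; last first.
  by have [H [? ? ? h]] := lnker_primitive_gt1 s1; exists H; split => // y *; exact: h.
have [|H [? ? h ?]] := @lnker_primitive_le1 s; first by rewrite s0.
exists H; split => //; rewrite ler0_sqrtr ?subr0//; nra.
Qed.

End Kernel.

(** * Choice of a good level by averaging a logarithmic singularity *)

Section Level.
Context {R : realType}.
Notation mu := (@lebesgue_measure R).
Implicit Types (x G : R -> R) (c y a u : R).

(** The number [2 / 2^k], in the shape summed by [cvg_geometric_eseries_half]. *)
Definition dyadic (k : nat) : R := 4 / (2 ^ (k + 0.+1))%:R.

Lemma dyadicS k : dyadic k.+1 = dyadic k / 2.
Proof. by rewrite /dyadic addSn expnS natrM invfM mulrCA mulrC. Qed.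

Lemma dyadic_gt0 k : 0 < dyadic k.
Proof. by rewrite divr_gt0// ltr0n expn_gt0. Qed.

Lemma dyadic_le k l : (k <= l)%N -> dyadic l <= dyadic k.
Proof.
by move=> kl; rewrite ler_pM2l// lef_pV2 ?posrE ?ltr0n ?expn_gt0// ler_nat leq_exp2l// leq_add2r.
Qed.

Lemma ln_dyadic k : ln (dyadic k) = ln 2 - k%:R * ln 2.
Proof.
elim: k => [|k IH]; first by rewrite mul0r subr0 /dyadic /=; congr ln; field.
rewrite dyadicS ln_div ?posrE ?dyadic_gt0// IH -(natr1 k); ring.
Qed.

Lemma ln2_le1 : ln 2 <= 1 :> R.
Proof. by have := @le_ln1Dx R 1; rewrite (_ : 1 + 1 = 2)// => ->//; rewrite ltrN10. Qed.

(** A layer-cake bound: about [log_2 (2 / u)] of the dyadic radii are at least [u], and [ln 2 <= 1].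
    The logarithm is thus dominated by a sum of indicators of intervals. At [u = 0] the convention
    [ln 0 = 0] leaves [ln 2], which a single term covers. *)
Lemma ln_le_dyadic_count u : 0 <= u ->
  ((ln 2 - ln u)%:E <= \sum_(0 <= k <oo) ((u <= dyadic k)%R%:R)%:E)%E.
Proof.
rewrite le_eqVlt => /predU1P[<-|u0].
  apply: le_trans; last by apply: (@nneseries_lim_ge _ _ _ 0%N 1).
  by rewrite big_nat1 (ltW (dyadic_gt0 _)) (ln0 (lexx 0)) subr0 lee_fin ln2_le1.
have H m : dyadic m < u -> ln 2 - ln u <= \sum_(0 <= k < m) ((u <= dyadic k)%R%:R).
  elim: m => [|m IH] hu.
    rewrite big_geq// subr_le0 ler_ln ?posrE//.
    by apply: le_trans (ltW hu); rewrite /dyadic/=; lra.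
  rewrite big_nat_recr//=; have [hu'|um] := ltP (dyadic m) u.
    by rewrite addr0; exact: IH.
  have -> : \sum_(0 <= i < m) ((u <= dyadic i)%R%:R) = m%:R :> R.
    rewrite big_mkord (eq_bigr (fun=> 1)); last first.
      by move=> i _; rewrite (le_trans um)// dyadic_le// ltnW.
    by rewrite sumr_const card_ord.
  have : ln (dyadic m.+1) <= ln u by rewrite ler_ln ?posrE ?dyadic_gt0 ?ltW.
  rewrite ln_dyadic -(natr1 m).
  have h2 : (m%:R + 1) * ln 2 <= m%:R + 1 :> R.
    by rewrite ler_piMr ?ln2_le1// addr_ge0.
  by rewrite /=; lra.
have [m hm] : exists m, dyadic m < u.
  have [m hm] : exists m : nat, 4 / u < m%:R.
    by exists (Num.bound (4 / u)); rewrite archi_boundP// divr_ge0// ltW.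
  exists m; rewrite /dyadic ltr_pdivrMr ?ltr0n ?expn_gt0//.
  rewrite mulrC -ltr_pdivrMr// (lt_trans hm)// ltr_nat addn1.
  by rewrite (leq_ltn_trans (leqnSn m))// ltn_expl.
apply: le_trans; last exact: (@nneseries_lim_ge _ _ _ _ m).
by rewrite sumEFin lee_fin; exact: H.
Qed.

Lemma measurable_ln_dist a : measurable_fun setT (fun c : R => ln 2 - ln `|a - c|).
Proof.
apply: measurable_funB; first exact: measurable_cst.
apply: measurableT_comp; first exact: measurable_ln.
by apply: measurableT_comp => //; apply: measurable_funB.
Qed.

Lemma measurable_closed_ball a r : measurable [set c : R | `|a - c| <= r].
Proof.
have -> : [set c : R | `|a - c| <= r] = `[a - r, a + r]%classic.
  by apply/seteqP; split => c /=; rewrite in_itv/= ler_distlC.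
exact: measurable_itv.
Qed.

(** The interval of radius [dyadic k] around [a] has length [4 / 2^k]; these lengths add up to 8. *)
Lemma ln_integral_bound a : -1 <= a <= 1 ->
  (\int[mu]_(c in `](-1)%R, 1%R[) (ln 2 - ln `|a - c|)%:E <= 8%:E)%E.
Proof.
move=> a1.
pose B k := [set c : R | `|a - c| <= dyadic k].
have mB k : measurable (B k) by exact: measurable_closed_ball.
have m1 : measurable (`](-1)%R, 1%R[%classic : set R) by exact: measurable_itv.
have mi k : measurable_fun (`](-1)%R, 1%R[%classic : set R) (fun c : R => (\1_(B k) c)%:E : \bar R).
  by apply/measurable_EFinP; exact: measurable_funTS.
have pi0 (k : nat) (c : R) : (0 <= (\1_(B k) c)%:E :> \bar R)%E by rewrite lee_fin indicE.
have cB c : (\sum_(0 <= k <oo) ((\1_(B k) c)%:E : \bar R) =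
             \sum_(0 <= k <oo) ((`|a - c| <= dyadic k)%R%:R)%:E)%E.
  by apply: eq_eseriesr => k _; rewrite indicE mem_setE.
apply: (@le_trans _ _ (\int[mu]_(c in `](-1)%R, 1%R[) (\sum_(0 <= k <oo) ((\1_(B k) c)%:E)))%E).
  apply: ge0_le_integral => //.
  - move=> c /=; rewrite in_itv/= => c1; rewrite lee_fin subr_ge0.
    have [->|n0] := eqVneq (a - c) 0.
      by rewrite normr0 (ln0 (lexx 0)) ln_ge0// ler1n.
    by rewrite ler_ln ?posrE ?normr_gt0// ler_norml; lra.
  - by apply/measurable_EFinP; apply: measurable_funTS; exact: measurable_ln_dist.
  - by apply: (@ge0_emeasurable_sum _ _ _ _ _ xpredT) => [k c _ _|k _]; [exact: pi0|exact: mi].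
  - by move=> c _; rewrite cB; apply: ln_le_dyadic_count.
rewrite integral_nneseries//.
have le_k k : (\int[mu]_(c in `](-1)%R, 1%R[) (\1_(B k) c)%:E <= (8 / (2 ^ (k + 0.+1))%:R)%:E)%E.
  rewrite (integral_indic mu m1 (mB k)); apply: (@le_trans _ _ (mu (B k))).
    apply: le_measure; last exact: subIsetl; rewrite inE; last exact: mB.
    exact: (measurableI _ _ (mB k) m1).
  have -> : B k = `[a - dyadic k, a + dyadic k]%classic.
    by apply/seteqP; split => c /=; rewrite /B/= in_itv/= ler_distlC.
  rewrite lebesgue_measure_itv/= lte_fin; case: ifP => _; last by rewrite lee_fin.
  by rewrite -EFinD lee_fin /dyadic; lra.
apply: (@le_trans _ _ (\sum_(0 <= k <oo) (8 / (2 ^ (k + 0.+1))%:R)%:E)%E).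
  by apply: lee_nneseries => // k _ _; exact: integral_ge0.
have := @cvg_geometric_eseries_half R 8 0; rewrite expr0 divr1 => /cvg_lim.
by move=> <-.
Qed.
(** If the inner integral exceeded 5 for every [c] in ]-1, 1[, the double integral would be at least
    10, while integrating over [c] first gives at most 8. *)
Lemma exists_level_integral x : continuous x -> (forall y, `|x y| <= 1) ->
  exists2 c, -1 < c < 1 &
    (\int[mu]_(y in `[0%R, 1%R]) (ln 2 - ln `|x y - c|)%:E <= 5%:E)%E.
Proof.
move=> cx x1.
pose J : set R := `](-1)%R, 1%R[%classic.
pose I : set R := `[0%R, 1%R]%classic.
have mJ : measurable J by exact: measurable_itv.
have mI : measurable I by exact: measurable_itv.
have muJ : mu J = 2%:E.
  by rewrite /J lebesgue_measure_itv/= lte_fin ifT -?EFinD; [congr EFin|]; lra.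
have muI : mu I = 1%:E.
  by rewrite /I lebesgue_measure_itv/= lte_fin ifT -?EFinD; [congr EFin|]; lra.
pose g c y := ln 2 - ln `|x y - c|.
(* The indicators extend the integrand to the plane and keep it nonnegative: for [c] in [J],
   [|x y - c| <= 2], which is what the summand [ln 2] compensates. *)
pose f (z : R * R) := (g z.1 z.2 * \1_J z.1 * \1_I z.2)%:E.
have g0 c y : c \in J -> 0 <= g c y.
  rewrite inE /J/= in_itv/= => c1; rewrite subr_ge0.
  have [->|n0] := eqVneq (x y - c) 0.
    by rewrite normr0 (ln0 (lexx 0)) ln_ge0// ler1n.
  by rewrite ler_ln ?posrE ?normr_gt0//; move: (x1 y); rewrite !ler_norml; lra.
have f0 z : (0 <= f z)%E.
  rewrite lee_fin /f !indicE; case: (boolP (z.1 \in J)) => zJ; last by rewrite mulr0 mul0r.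
  by rewrite mulr1 mulr_ge0 ?g0.
have mx : measurable_fun setT x by exact: continuous_measurable_fun.
have mf : measurable_fun setT f.
  apply/measurable_EFinP; apply: measurable_funM; [apply: measurable_funM|].
  - apply: measurable_funB; first exact: measurable_cst.
    apply: measurableT_comp; first exact: measurable_ln.
    apply: measurableT_comp => //; apply: measurable_funB; last exact: measurable_fst.
    by apply: measurableT_comp => //; exact: measurable_snd.
  - by apply: (measurableT_comp _ measurable_fst); exact: measurable_indic.
  - by apply: (measurableT_comp _ measurable_snd); exact: measurable_indic.
have F1 c : (\int[mu]_y f (c, y))%E = (if c \in J then \int[mu]_(y in I) (g c y)%:E else 0)%E.
  case: ifPn => cJ; last first.
    by apply: integral0_eq => y _; rewrite /f/= indicE (negPf cJ) mulr0 mul0r.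
  rewrite [RHS]integral_mkcond; apply: eq_integral => y _.
  by rewrite /f/= !indicE cJ mulr1 /patch; case: ifP; rewrite ?mulr1 ?mulr0.
have F2 y : (\int[mu]_c f (c, y))%E = (if y \in I then \int[mu]_(c in J) (g c y)%:E else 0)%E.
  case: ifPn => yI; last first.
    by apply: integral0_eq => c _; rewrite /f/= !indicE (negPf yI) mulr0.
  rewrite [RHS]integral_mkcond; apply: eq_integral => c _.
  by rewrite /f/= !indicE yI mulr1 /patch; case: ifP; rewrite ?mulr1 ?mulr0.
apply: contrapT => nex.
have big c : c \in J -> (5%:E <= \int[mu]_(y in I) (g c y)%:E)%E.
  move=> cJ; rewrite leNgt; apply/negP => h; apply: nex; exists c; last exact: ltW.
  by move: cJ; rewrite inE /J/= in_itv.
have TT := @fubini_tonelli _ _ _ _ _ mu mu f mf f0.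
have L : (10%:E <= \int[mu]_c \int[mu]_y f (c, y))%E.
  apply: (@le_trans _ _ (\int[mu]_c (cst 5%:E \_ J) c)%E).
    have -> : (\int[mu]_c (cst 5%:E \_ J) c = 5%:E * mu J)%E.
      by rewrite -integral_mkcond; exact: integral_cst.
    by rewrite muJ -EFinM lee_fin; lra.
  apply: ge0_le_integral; first exact: measurableT.
  - by move=> c _; rewrite /patch; case: ifP => _; [rewrite lee_fin ler0n|exact: lexx].
  - apply/(measurable_restrict _ mJ measurableT); exact: measurable_cst.
  - exact: measurable_fun_fubini_tonelli_F.
  - move=> c _; rewrite F1 /patch; case: ifP => [/big h|_]; [exact: h|exact: lexx].
have U : (\int[mu]_y \int[mu]_c f (c, y) <= 8%:E)%E.
  apply: (@le_trans _ _ (\int[mu]_y (cst 8%:E \_ I) y)%E); last first.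
    have -> : (\int[mu]_c (cst 8%:E \_ I) c = 8%:E * mu I)%E.
      by rewrite -integral_mkcond; exact: integral_cst.
    by rewrite muI -EFinM lee_fin; lra.
  apply: ge0_le_integral; first exact: measurableT.
  - by move=> y _; apply: integral_ge0 => c _; exact: f0.
  - exact: measurable_fun_fubini_tonelli_G.
  - apply/(measurable_restrict _ mI measurableT); exact: measurable_cst.
  - move=> y _; rewrite F2 /patch; case: ifP => _; last exact: lexx.
    by apply: ln_integral_bound; rewrite -ler_norml.
by rewrite TT in L; move: (le_trans L U); rewrite lee_fin; lra.
Qed.
(** The projection onto [0, 1], written so that continuity is immediate; it extends functions given
    on [0, 1] to the line. *)
Definition clamp01 y : R := (1 + `|y| - `|y - 1|) / 2.

Lemma clamp01_id y : 0 <= y <= 1 -> clamp01 y = y.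
Proof.
by move=> /andP[y0 y1]; rewrite /clamp01 ger0_norm// ler0_norm ?subr_le0//; field.
Qed.

Lemma clamp01_itv y : 0 <= clamp01 y <= 1.
Proof.
rewrite /clamp01; case: (ger0P y) => y0; case: (ger0P (y - 1)) => y1; lra.
Qed.

Lemma continuous_clamp01 : continuous clamp01.
Proof.
move=> y; apply: (@contM _ (fun y => 1 + `|y| - `|y - 1|) (fun=> 2^-1)); last exact: cont_cst.
apply: contB; first by apply: contD; [exact: cont_cst|exact: norm_continuous].
apply: (@cont_comp _ (fun y => y - 1)); last exact: norm_continuous.
by apply: contB; [exact: cont_id|exact: cont_cst].
Qed.

(* The average over [c] of the integral of [- ln |x y - c|] is bounded by
   Tonelli's theorem; [G] plays the role of a primitive of the integrand. *)
Lemma exists_level x :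
  (forall y, 0 <= y <= 1 -> {for y, continuous x}) ->
  (forall y, 0 <= y <= 1 -> `|x y| <= 1) ->
  exists2 c, -1 < c < 1 & forall (Z : seq R) G (dG : R -> R) (M : R),
    (forall y, 0 <= y <= 1 -> {for y, continuous G}) ->
    (forall y, 0 < y < 1 -> y \notin Z ->
      [/\ x y != c, is_derive y 1 G (dG y) & dG y <= M - ln `|x y - c|]) ->
    G 1 - G 0 <= M + 5.
Proof.
move=> cx x1; pose x' y := x (clamp01 y).
have cx' : continuous x'.
  move=> y; apply: (@cont_comp _ clamp01); first exact: continuous_clamp01.
  by apply: cx; exact: clamp01_itv.
have [c c1 ic] := exists_level_integral cx' (fun y => x1 _ (clamp01_itv y)).
exists c => // Z G dG M cG hG.
pose p y := ln 2 - ln `|x' y - c|.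
have p0 y : 0 <= p y.
  rewrite subr_ge0.
  have [->|n0] := eqVneq (x' y - c) 0.
    by rewrite normr0 (ln0 (lexx 0)) ln_ge0// ler1n.
  rewrite ler_ln ?posrE ?normr_gt0//; move: (x1 _ (clamp01_itv y)).
  by rewrite -/(x' y) !ler_norml; lra.
have mp : measurable_fun setT p.
  apply: measurable_funB; first exact: measurable_cst.
  apply: measurableT_comp; first exact: measurable_ln.
  apply: measurableT_comp => //; apply: measurable_funB; last exact: measurable_cst.
  exact: continuous_measurable_fun.
have ip : mu.-integrable `[0, 1] (EFin \o p).
  apply/integrableP; split; first by apply/measurable_EFinP; exact: measurable_funTS.
  under eq_integral do rewrite /= ger0_norm//.
  by rewrite (le_lt_trans ic)// ltry.
pose F y := parameterized_integral mu 0 y p.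
have F0 : F 0 = 0 by rewrite /F /parameterized_integral set_itv1 Rintegral_set1.
have F1 : F 1 <= 5.
  rewrite /F /parameterized_integral /Rintegral -lee_fin fineK//.
  exact: integrable_fin_num.
have cF : {within `[0, 1], continuous F}.
  exact: parameterized_integral_continuous.
have cG' : {within `[0, 1], continuous (fun y => G y - (M - ln 2) * y)}.
  apply: within_continuous_itv => y y01; apply: contB; first exact: cG.
  by apply: contZ; exact: cont_id.
(* The hypothesis on [dG] says [dG y <= (M - ln 2) + p y], so [W] is nondecreasing. *)
pose W y := F y - (G y - (M - ln 2) * y).
have dW y : 0 < y < 1 -> y \notin Z -> is_derive y 1 W (p y - (dG y - (M - ln 2))).
  move=> y01 yZ; have [xc dGy _] := hG y y01 yZ; case/andP: y01 => y0 y1.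
  have x'y : x' y = x y by rewrite /x' clamp01_id ?ltW.
  apply: is_derive1B.
    have cp : {for y, continuous p}.
      apply: contB; first exact: cont_cst.
      apply: cont_lnabs; first by rewrite subr_eq0 x'y.
      by apply: contB; [exact: cx'|exact: cont_cst].
    have [dF eF] := continuous_FTC1_closed y1 ip y0 cp.
    by rewrite -eF derive1E; exact: derivableP.
  apply: is_derive1B => //.
  by apply: (is_derive_eq (is_derive1_Zl _ (is_derive1_id y))); rewrite mulr1.
have : W 0 <= W 1.
  apply: (le_derive_off_finite ler01 _ dW).
    by move=> y; apply: cvgB; [exact: cF|exact: cG'].
  move=> y y01 yZ; have [xc dGy le] := hG y y01 yZ.
  rewrite /p /x' clamp01_id; first by lra.
  by case/andP: y01 => y0 y1; rewrite !ltW.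
have := @ln_ge0 R 2; rewrite ler1n => /(_ isT).
by rewrite /W F0; lra.
Qed.

End Level.

(** * The potential [jouk] and its variation along interlacing points *)

Section Jouk.
Context {R : realType}.
Implicit Types (s u : R).

(* By [lnker_primitive], [pi * jouk s] is the integral of [lnker] against the
   arcsine-type weight; [Num.sqrt] vanishes on negative arguments, so that
   [jouk s = s] for [s <= 1]. *)
Definition jouk s : R := s - Num.sqrt (s ^+ 2 - 1).

Lemma jouk_le1 s : 0 <= s <= 1 -> jouk s = s.
Proof. by move=> s1; rewrite /jouk ler0_sqrtr ?subr0//; nra. Qed.

Lemma sqr_sqrt_jouk s : 1 <= s -> Num.sqrt (s ^+ 2 - 1) ^+ 2 = s ^+ 2 - 1.
Proof. by move=> s1; rewrite sqr_sqrtr//; nra. Qed.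

Lemma jouk_ge1 s : 1 <= s -> jouk s = (s + Num.sqrt (s ^+ 2 - 1))^-1.
Proof.
move=> s1; have e := sqr_sqrt_jouk s1; have k0 := sqrtr_ge0 (s ^+ 2 - 1).
have p : s + Num.sqrt (s ^+ 2 - 1) != 0 by rewrite gt_eqF//; lra.
apply: (mulIf p); rewrite mulVf// /jouk; by ring: e.
Qed.

Lemma jouk_ge0 s : 0 <= s -> 0 <= jouk s.
Proof.
move=> s0; have [s1|s1] := leP s 1; first by rewrite jouk_le1// s0.
by rewrite (jouk_ge1 (ltW s1)) invr_ge0 addr_ge0// sqrtr_ge0.
Qed.

Lemma jouk_antitone s u : 1 <= s -> s <= u -> jouk u <= jouk s.
Proof.
move=> s1 su; rewrite !jouk_ge1//; last exact: le_trans su.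
have ks := sqrtr_ge0 (s ^+ 2 - 1).
rewrite lef_pV2 ?posrE; last 2 first.
  by rewrite ltr_pwDl//; have := sqrtr_ge0 (u ^+ 2 - 1); lra.
  by rewrite ltr_pwDl//; lra.
by rewrite lerD// ler_sqrt; nra.
Qed.

Lemma jouk1 : jouk 1 = 1.
Proof. by rewrite jouk_le1 ?lexx ?ler01. Qed.

Lemma jouk_ub s : 0 <= s -> jouk s <= 1.
Proof.
move=> s0; have [s1|s1] := leP s 1; first by rewrite jouk_le1// s0.
by rewrite -jouk1; apply: jouk_antitone => //; exact: ltW.
Qed.

Lemma jouk_lb s : 1 <= s -> s^-1 / 2 <= jouk s.
Proof.
move=> s1; have e := sqr_sqrt_jouk s1; have k0 := sqrtr_ge0 (s ^+ 2 - 1).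
rewrite jouk_ge1// -invfM lef_pV2 ?posrE; [|lra..].
nra.
Qed.

(** [jouk] rises from 0 to 1 on [0, 1] and then decreases. This splits it into a difference of two
    nondecreasing functions with values in [0, 1], hence total variation at most 2. *)
Definition joukD s : R := Num.min s 1 - jouk s.

Lemma joukD_ge0 s : 0 <= s -> 0 <= joukD s <= 1.
Proof.
move=> s0; rewrite /joukD; have := jouk_ub s0; have := jouk_ge0 s0.
have [s1|s1] := leP s 1; last lra.
by rewrite jouk_le1 ?s0//; lra.
Qed.

Lemma joukD_mono s u : 0 <= s -> s <= u -> joukD s <= joukD u.
Proof.
move=> s0 su; have u0 := le_trans s0 su.
have [s1|s1] := leP s 1.
  have -> : joukD s = 0 by rewrite /joukD min_l// jouk_le1 ?s0// subrr.
  by have /andP[] := joukD_ge0 u0.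
have u1 := lt_le_trans s1 su.
by rewrite /joukD (min_r (ltW s1)) (min_r (ltW u1)) lerD2l lerN2 jouk_antitone// ltW.
Qed.

(** The [i]-th difference is at most the increment of [f] over the common interval of [t i] and
    [t' i], and these increments telescope: the bound does not grow with [n]. *)
Lemma interlacing_sum n (a : nat -> R) (f : R -> R) (t t' : 'I_n -> R) :
  0 <= a 0%N ->
  (forall i : 'I_n, a i < t i < a i.+1 /\ a i < t' i < a i.+1) ->
  (forall s u, 0 <= s -> s <= u -> f s <= f u) ->
  (forall s, 0 <= s -> 0 <= f s <= 1) ->
  \sum_(i < n) f (t i) - \sum_(i < n) f (t' i) <= 1.
Proof.
move=> a0 ht mf f01.
have age0 i : (i <= n)%N -> 0 <= a i.
  elim: i => [//|i IH] iln; have [/andP[h1 h2] _] := ht (Ordinal iln).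
  by have := IH (ltnW iln); move: h1 h2 => /=; lra.
have h : \sum_(i < n) (f (t i) - f (t' i)) <= \sum_(i < n) (f (a i.+1) - f (a i)).
  apply: ler_sum => i _; have [/andP[h1 h2] /andP[h3 h4]] := ht i.
  have ai : 0 <= a i by apply: age0; rewrite ltnW.
  by apply: lerB; apply: mf; lra.
rewrite -sumrB (le_trans h)// -(big_mkord xpredT (fun i => f (a i.+1) - f (a i))).
rewrite telescope_sumr//.
by have := f01 _ (age0 n (leqnn n)); have := f01 _ a0; lra.
Qed.

Lemma interlacing_jouk n (a : nat -> R) (al : R) (t t' : 'I_n -> R) : 0 < al ->
  0 <= a 0%N ->
  (forall i : 'I_n, a i < t i < a i.+1 /\ a i < t' i < a i.+1) ->
  \sum_(i < n) jouk (t i / al) - \sum_(i < n) jouk (t' i / al) <= 2.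
Proof.
move=> al0 a0 ht.
have e (s : R) : jouk (s / al) = Num.min (s / al) 1 - joukD (s / al).
  by rewrite /joukD opprB addrCA subrr addr0.
have es (v : 'I_n -> R) : \sum_(i < n) jouk (v i / al) =
    \sum_(i < n) Num.min (v i / al) 1 - \sum_(i < n) joukD (v i / al).
  by rewrite -sumrB; apply: eq_bigr => i _; exact: e.
rewrite !es.
have h1 : \sum_(i < n) Num.min (t i / al) 1 - \sum_(i < n) Num.min (t' i / al) 1 <= 1.
  apply: (@interlacing_sum n a (fun s => Num.min (s / al) 1)) => // s.
  - move=> u s0 su; rewrite le_min2// ler_pM2r// invr_gt0//.
  - move=> s0; rewrite le_min ler01 andbT divr_ge0 ?(ltW al0)//=.
    by rewrite ge_min lexx orbT.
have h2 : \sum_(i < n) joukD (t' i / al) - \sum_(i < n) joukD (t i / al) <= 1.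
  apply: (@interlacing_sum n a (fun s => joukD (s / al))) => //.
  - by move=> i; have [? ?] := ht i.
  - move=> s u s0 su; apply: joukD_mono; first by rewrite divr_ge0// ltW.
    by rewrite ler_pM2r// invr_gt0.
  - by move=> s s0; apply: joukD_ge0; rewrite divr_ge0// ltW.
lra.
Qed.

End Jouk.

(** * Bounds for the arctangent, and the primitive that counts points *)

Section Atan.
Context {R : realType}.
Implicit Types v s al : R.

Lemma is_derive1_atan_chain (f : R -> R) (x df : R) : is_derive x 1 f df ->
  is_derive x 1 (fun y => atan (f y)) (df / (1 + f x ^+ 2)).
Proof. by move=> hf; rewrite mulrC; exact: is_derive1_chain (is_derive1_atan _) hf. Qed.

Lemma atan_ge0 v : 0 <= v -> 0 <= atan v.
Proof. by move=> v0; rewrite -atan0 le_atan. Qed.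

Lemma atan_le v : 0 <= v -> atan v <= v.
Proof.
move=> v0; rewrite -subr_ge0.
have {1}<- : 0 - atan 0 = 0 :> R by rewrite atan0 subr0.
apply: (@le_derive_off_finite _ [::] (fun y => y - atan y) (fun y => 1 - 1 / (1 + y ^+ 2))) => //.
- apply: within_continuous_itv => x _; apply: contB; first exact: cont_id.
  exact: continuous_atan.
- move=> x _ _.
  exact: (is_derive1B (is_derive1_id x) (is_derive1_atan_chain (is_derive1_id x))).
- move=> x _ _; rewrite subr_ge0 ler_pdivrMr; have := sqr_ge0 x; lra.
Qed.

(** Concavity of [atan] on the positive axis. Together with [atan_le] it encloses
    [sum_i atan (t_i v)] between [T * atan v] and [T * v]. *)
Lemma atan_mul_ge s v : 0 <= s <= 1 -> 0 <= v -> s * atan v <= atan (s * v).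
Proof.
move=> s01 v0; rewrite -subr_ge0.
have {1}<- : atan (s * 0) - s * atan 0 = 0 :> R by rewrite mulr0 atan0 mulr0 subr0.
apply: (@le_derive_off_finite _ [::] (fun y => atan (s * y) - s * atan y)
  (fun y => (s * 1) / (1 + (s * y) ^+ 2) - s * (1 / (1 + y ^+ 2)))) => //.
- apply: within_continuous_itv => x _; apply: contB.
    apply: (@cont_comp _ (fun y => s * y)); last exact: continuous_atan.
    by apply: contZ; exact: cont_id.
  by apply: contZ; exact: continuous_atan.
- move=> x _ _.
  have ix := is_derive1_id x.
  exact: (is_derive1B (is_derive1_atan_chain (is_derive1_Zl s ix))
    (is_derive1_Zl s (is_derive1_atan_chain ix))).
- move=> x _ _; rewrite mulr1 div1r -mulrBr mulr_ge0//; first by case/andP: s01.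
  have x2 := sqr_ge0 x.
  rewrite subr_ge0 lef_pV2 ?posrE; last 2 first.
    by lra.
    by have := sqr_ge0 (s * x); lra.
  by rewrite lerD2l exprMn ler_piMl// exprn_ile1//; case/andP: s01.
Qed.

Lemma asinc_ge0 v : 0 <= v -> 0 <= asinc v.
Proof.
by move=> v0; rewrite mulr_ge0// atan_ge0// divr_ge0// addr_ge0// sqrtr_ge0.
Qed.

Lemma asinc_le v : 0 <= v -> asinc v <= 2 * v.
Proof.
move=> v0; rewrite ler_pM2l//.
have p : 1 <= 1 + Num.sqrt (1 - v ^+ 2) by rewrite lerDl sqrtr_ge0.
apply: le_trans (atan_le _) _; first by rewrite divr_ge0//; lra.
by rewrite ler_pdivrMr ?ler_peMr//; lra.
Qed.

(* A primitive of [jouk (s / al) / al] in the variable [al], running from [0] at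
   [0] to [pi / 2] at infinity whatever [s] is: this is what counts points. *)
Definition jouk_prim s al : R := asinc (clamp01 (al / s)) - jouk (s / al).

Lemma continuous_jouk_prim s al : 0 < s -> 0 < al ->
  {for al, continuous (jouk_prim s)}.
Proof.
move=> s0 al0; have cs : {for al, continuous (fun al => s / al)}.
  by apply: cont_div; [rewrite gt_eqF|exact: cont_cst|exact: cont_id].
apply: contB.
  apply: (@cont_comp _ (fun al => clamp01 (al / s))); last exact: continuous_asinc.
  apply: (@cont_comp _ (fun al => al / s)); last exact: continuous_clamp01.
  by apply: contM; [exact: cont_id|exact: cont_cst].
apply: contB => //; apply: cont_sqrt; apply: contB; last exact: cont_cst.
by apply: (cont_comp cs (g := fun x => x ^+ 2)); exact: exprn_continuous.
Qed.

Lemma is_derive1_jouk_prim s al : 0 < s -> 0 < al -> al != s ->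
  is_derive al 1 (jouk_prim s) (jouk (s / al) / al).
Proof.
move=> s0 al0 als.
have an : al != 0 by rewrite gt_eqF.
have sn : s != 0 by rewrite gt_eqF.
have ds := is_derive1_div (is_derive1_const s al) (is_derive1_id al) an.
move: als; rewrite neq_lt => /orP[als|als].
- pose f y := asinc (y / s) - (s / y - Num.sqrt ((s / y) ^+ 2 - 1)).
  apply: (near_eq_is_derive (f := f)).
    near=> y; have y0 : 0 < y by near: y; apply: lt_nbhsr.
    have ys : y < s by near: y; apply: lt_nbhsl.
    rewrite /f /jouk_prim clamp01_id//.
    by rewrite divr_ge0 ?ltW//= ltr_pdivrMr// mul1r.
  have u1 : -1 < al / s < 1.
    have : al / s < 1 by rewrite ltr_pdivrMr// mul1r.
    have : 0 < al / s by rewrite divr_gt0.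
    by lra.
  have sa : 1 < s / al by rewrite ltr_pdivlMr// mul1r.
  have q0 : 0 < (s / al) ^+ 2 - 1 by nra.
  have das := is_derive1_div (is_derive1_id al) (is_derive1_const s al) sn.
  have dq := is_derive1_sqrt (is_derive1B (is_derive1_sqr ds) (is_derive1_const 1 al)) q0.
  apply: (is_derive_eq (is_derive1B (is_derive1_asinc das u1) (is_derive1B ds dq))).
  rewrite /jouk.
  have -> : 1 - (al / s) ^+ 2 = (al / s) ^+ 2 * ((s / al) ^+ 2 - 1) by field; rewrite an.
  rewrite sqrtrM ?sqr_ge0// sqrtr_sqr (gtr0_norm (divr_gt0 al0 s0)).
  have w0 : 0 < Num.sqrt ((s / al) ^+ 2 - 1) by rewrite sqrtr_gt0.
  have w2 : Num.sqrt ((s / al) ^+ 2 - 1) ^+ 2 = (s / al) ^+ 2 - 1 by rewrite sqr_sqrtr// ltW.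
  move: (Num.sqrt _) w0 w2 => w w0 w2; have wn : w != 0 by rewrite gt_eqF.
  apply/eqP; rewrite -subr_eq0; apply/eqP.
  transitivity ((w ^+ 2 - ((s / al) ^+ 2 - 1)) / (al * w)); last by rewrite w2 subrr mul0r.
  by field; rewrite an wn sn.
- pose f (y : R) := pi / 2 - s / y.
  apply: (near_eq_is_derive (f := f)).
    near=> y; have ys : s < y by near: y; apply: lt_nbhsr.
    have y0 := lt_trans s0 ys.
    rewrite /f /jouk_prim jouk_le1; last by rewrite divr_ge0 ?ltW//= ltr_pdivrMr// mul1r.
    congr (_ - _); rewrite -asinc1; congr asinc.
    have h : 1 <= y / s by rewrite ler_pdivlMr// mul1r ltW.
    by rewrite /clamp01 !ger0_norm ?subr_ge0//; lra.
  apply: (is_derive_eq (is_derive1B (is_derive1_const _ al) ds)).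
  rewrite jouk_le1; last by rewrite divr_ge0 ?ltW//= ltr_pdivrMr// mul1r.
  by field.
Unshelve. all: by end_near. Qed.

End Atan.

(** * Potential estimates for an oscillating error *)

Section Oscillation.
Context {R : realType}.
Implicit Types (c y z al : R).

(* [e] oscillates [n] times between [- E] and [E] on [0, 1]: for each level
   [c] in ]-1, 1[, the [t c i] are the solutions of [e z = c * E], one in each
   interval of monotonicity; [t_prod] expresses the Blaschke product of
   the [t c i] through [e]. *)
Record oscillating n (E : R) (e : R -> R) (a : nat -> R)
    (t : R -> 'I_n -> R) : Prop := Oscillating {
  osc_E_gt0 : 0 < E;
  osc_E_le1 : E <= 1;
  osc_cont : forall z, 0 <= z <= 1 -> {for z, continuous e};
  osc_le : forall z, 0 <= z <= 1 -> `|e z| <= E;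
  osc_a0 : 0 <= a 0%N;
  osc_an : a n <= 1;
  osc_itv : forall c (i : 'I_n), -1 < c < 1 -> a i < t c i < a i.+1;
  osc_prod : forall c z, -1 < c < 1 -> 0 <= z <= 1 ->
    \prod_(i < n) (z - t c i) * (2 * z - e z + c * E) =
    \prod_(i < n) (z + t c i) * (e z - c * E) }.

Variables (n : nat) (E : R) (e : R -> R) (a : nat -> R) (t : R -> 'I_n -> R).
Hypothesis osc : oscillating E e a t.

Let E0 : 0 < E := osc_E_gt0 osc.
Let E1 : E <= 1 := osc_E_le1 osc.

Lemma osc_a_ge0 i : (i <= n)%N -> 0 <= a i.
Proof.
elim: i => [|i IH] iln; first exact: osc_a0 osc.
have /andP[h1 h2] : a i < t 0 (Ordinal iln) < a i.+1.
  by apply: (@osc_itv _ _ _ _ _ osc 0 (Ordinal iln)); rewrite ltrN10 ltr01.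
by have := IH (ltnW iln); lra.
Qed.

Lemma osc_a_le1 i : (i <= n)%N -> a i <= 1.
Proof.
move=> iln; rewrite -(subKn iln); move: (n - i)%N (leq_subr i n) => j.
elim: j => [_|j IH jn]; first by rewrite subn0; exact: osc_an osc.
have h : (n - j.+1 < n)%N by lia.
have /andP[h1 h2] : a (n - j.+1)%N < t 0 (Ordinal h) < a (n - j.+1).+1.
  by apply: (@osc_itv _ _ _ _ _ osc 0 (Ordinal h)); rewrite ltrN10 ltr01.
have := IH (ltnW jn); have -> : (n - j = (n - j.+1).+1)%N by lia.
by lra.
Qed.

Lemma osc_t_itv c i : -1 < c < 1 -> 0 < t c i < 1.
Proof.
move=> c1; have /andP[h1 h2] := osc_itv osc i c1.
have := @osc_a_ge0 i (ltnW (ltn_ord i)); have := @osc_a_le1 i.+1 (ltn_ord i).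
by lra.
Qed.

Lemma osc_lnker_sum c z : -1 < c < 1 -> 0 < z <= 1 -> (forall i, z != t c i) ->
  [/\ e z - c * E != 0, 2 * z - e z + c * E != 0 &
   \sum_(i < n) lnker z (t c i) = ln `|2 * z - e z + c * E| - ln `|e z - c * E|].
Proof.
move=> c1 /andP[z0 z1] zt.
have P := osc_prod osc c1 (z := z); rewrite z1 ltW// in P; have {}P := P isT.
have n1 i : z - t c i != 0 by rewrite subr_eq0.
have n2 i : z + t c i != 0.
  by rewrite gt_eqF// addr_gt0//; case/andP: (osc_t_itv i c1).
have p1 : \prod_(i < n) (z - t c i) != 0 by apply/prodf_neq0.
have p2 : \prod_(i < n) (z + t c i) != 0 by apply/prodf_neq0.
(* Since [z] avoids the [t c i], the vanishing of one error factor in [osc_prod] forces that of the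
   other, but their sum is [2 z > 0]. *)
have ec : e z - c * E != 0.
  apply/eqP => e0; move/eqP: P; rewrite e0 mulr0 mulf_eq0 (negPf p1)/=.
  by move/eqP; lra.
have ez : 2 * z - e z + c * E != 0.
  apply/eqP => e0; move/eqP: P; rewrite e0 mulr0 eq_sym mulf_eq0 (negPf p2)/=.
  by rewrite (negPf ec).
split => //.
have lnprod (f : 'I_n -> R) : (forall i, f i != 0) ->
    \sum_(i < n) ln `|f i| = ln `|\prod_(i < n) f i|.
  move=> f0; rewrite normr_prod.
  suff [] : 0 < \prod_(i < n) `|f i| /\ \sum_(i < n) ln `|f i| = ln (\prod_(i < n) `|f i|) by [].
  elim/big_ind2: _ => [|x1 x2 y1 y2 [p -> ] [q ->]|i _].
  - by rewrite ln1 ltr01.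
  - by rewrite mulr_gt0// lnM.
  - by rewrite normr_gt0 f0.
rewrite sumrB !lnprod//; apply/eqP; rewrite subr_eq addrAC eq_sym subr_eq.
by rewrite -!lnM ?posrE ?normr_gt0// -!normrM mulrC P.
Qed.
Lemma lnker_scale al z s : 0 < al -> 0 < z -> 0 < s -> al * z != s ->
  lnker z (s / al) = lnker (al * z) s.
Proof.
move=> al0 z0 s0 zs; rewrite /lnker.
have an : al != 0 by rewrite gt_eqF.
have -> : al * z + s = al * (z + s / al) by field.
have -> : al * z - s = al * (z - s / al) by field.
have h1 : z + s / al != 0 by rewrite gt_eqF// addr_gt0// divr_gt0.
have h2 : z - s / al != 0.
  by apply: contra_neq zs => /eqP; rewrite subr_eq0 => /eqP ->; field.
by rewrite !normrM !lnM ?posrE ?normr_gt0//; ring.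
Qed.

(** The substitution [z = al sqrt (1 - y^2)] turns [z / sqrt (al^2 - z^2) dz] into [al dy], up to
    orientation, so that all [al] share the uniform weight on [0, 1]. *)
Lemma osc_primitive c al : -1 < c < 1 -> 0 < al <= 1 ->
  exists (Z : seq R) (F : R -> R),
  [/\ forall y, 0 <= y <= 1 -> {for y, continuous F},
      F 1 - F 0 = pi * \sum_(i < n) jouk (t c i / al) &
      forall y, 0 < y < 1 -> y \notin Z ->
      (forall i, al * Num.sqrt (1 - y ^+ 2) != t c i) /\
      is_derive y 1 F (\sum_(i < n) lnker (al * Num.sqrt (1 - y ^+ 2)) (t c i))].
Proof.
move=> c1 /andP[al0 al1].
have t0 i : 0 < t c i by case/andP: (osc_t_itv i c1).
have [H hH] := choice (fun i : 'I_n => lnker_primitive (divr_gt0 (t0 i) al0)).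
exists [seq Num.sqrt (1 - (t c i / al) ^+ 2) | i <- enum 'I_n].
exists (fun y => \sum_(i < n) H i y); split.
- by move=> y y01; apply: cont_sum => i; have [h _ _ _] := hH i; exact: h.
- rewrite -sumrB mulr_sumr; apply: eq_bigr => i _.
  by have [_ -> -> _] := hH i; rewrite subr0.
- move=> y y01 yZ.
  have T0 : 0 < Num.sqrt (1 - y ^+ 2) by rewrite sqrtr_gt0; nra.
  have ne i : Num.sqrt (1 - y ^+ 2) != t c i / al.
    apply: contraNneq yZ => h; apply/mapP; exists i; first by rewrite mem_enum.
    rewrite -h sqr_sqrtr; last nra.
    by rewrite subKr sqrtr_sqr gtr0_norm//; case/andP: y01.
  have ne' i : al * Num.sqrt (1 - y ^+ 2) != t c i.
    by apply: contra_neq (ne i) => <-; rewrite mulrC mulKf// gt_eqF.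
  split=> //; apply: is_derive1_sum => i.
  rewrite -lnker_scale//.
  by have [_ _ _ h] := hH i; exact: h.
Qed.

(** At level 0 the kernel sum is [ln |2 z - e z| - ln |e z|]. For [z >= E], [|e z| <= E] gives
    [|2 z - e z| >= z], so the sum is at least [ln (z / E)]. *)
Lemma osc_jouk_lower al : E <= al <= 1 ->
  ln (al / E) - 1 <= pi * \sum_(i < n) jouk (t 0 i / al).
Proof.
move=> /andP[Eal al1]; have al0 : 0 < al by exact: lt_le_trans Eal.
have c1 : -1 < (0 : R) < 1 by rewrite ltrN10 ltr01.
have [|Z [F [cF <- dF]]] := @osc_primitive 0 al c1; first by rewrite al0.
(* A primitive of [ln (al / E) + ln (1 - y)], which is below [ln (z / E)] because
   [sqrt (1 - y^2) >= 1 - y]; the loss 1 is the integral of [- ln (1 - y)]. *)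
pose P y := (ln (al / E) - 1) * y + (y - 1) * ln `|y - 1|.
have : F 0 - P 0 <= F 1 - P 1.
  pose dW y := \sum_(i < n) lnker (al * Num.sqrt (1 - y ^+ 2)) (t 0 i) -
    (ln (al / E) + ln `|y - 1|).
  apply: (@le_derive_off_finite _ Z (fun y => F y - P y) dW) => //.
  - apply: within_continuous_itv => y y01; apply: contB; first exact: cF.
    apply: contD; first by apply: contZ; exact: cont_id.
    apply: (@cont_comp _ (fun y => y - 1) (fun x => x * ln `|x|)); last exact: continuous_xln.
    by apply: contB; [exact: cont_id|exact: cont_cst].
  - move=> y y01 yZ; have [_ dFy] := dF y y01 yZ.
    apply: (is_derive1B dFy).
    have y1 : y - 1 != 0 by rewrite lt_eqF// subr_lt0; case/andP: y01.
    have i1 := is_derive1B (is_derive1_id y) (is_derive1_const 1 y).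
    apply: (is_derive_eq (is_derive1D (is_derive1_Zl _ (is_derive1_id y))
      (is_derive1M i1 (is_derive1_lnabs i1 y1)))).
    by field.
  - move=> y y01 yZ; have [zt _] := dF y y01 yZ; rewrite /dW.
    have T0 : 0 < Num.sqrt (1 - y ^+ 2) by rewrite sqrtr_gt0; nra.
    have T2 : Num.sqrt (1 - y ^+ 2) ^+ 2 = 1 - y ^+ 2 by rewrite sqr_sqrtr//; nra.
    have Ty : 1 - y <= Num.sqrt (1 - y ^+ 2) by nra.
    have T1 : Num.sqrt (1 - y ^+ 2) <= 1 by nra.
    move: zt; set z := al * _ => zt.
    have z0 : 0 < z by rewrite mulr_gt0.
    have zal : z <= al by rewrite /z ler_piMr// ltW.
    have z1 : z <= 1 by exact: le_trans al1.
    have yp : 0 < 1 - y by lra.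
    rewrite distrC (gtr0_norm yp) subr_ge0 -lnM ?posrE ?divr_gt0//.
    apply: (@le_trans _ _ (ln (z / E))).
      rewrite ler_ln ?posrE ?mulr_gt0 ?invr_gt0//.
      by rewrite /z -!mulrA ler_pM2l// mulrC ler_pM2r// invr_gt0.
    (* Below [E] the target [ln (z / E)] is negative, while every term of the kernel sum is
       nonnegative. *)
    have [zE|Ez] := ltP z E.
      apply: (@le_trans _ _ 0); first by rewrite ln_le0// ler_pdivrMr// mul1r ltW.
      apply: sumr_ge0 => i _; have /andP[ti0 _] := osc_t_itv i c1.
      rewrite /lnker subr_ge0 ler_ln ?posrE ?normr_gt0 ?subr_eq0//; last first.
        by rewrite gt_eqF// addr_gt0.
      by rewrite (gtr0_norm (addr_gt0 z0 ti0)) ler_norml; lra.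
    have z01 : 0 < z <= 1 by rewrite z0.
    have [n1 n2 ->] := osc_lnker_sum c1 z01 zt.
    move: n1 n2; rewrite mul0r subr0 addr0 => n1 n2.
    have eE : `|e z| <= E by apply: (osc_le osc); rewrite ltW.
    have hz : z <= `|2 * z - e z|.
      by have := ler_norm (2 * z - e z); have := ler_norm (e z); lra.
    rewrite ln_div ?posrE// lerB// ler_ln ?posrE ?normr_gt0//.
rewrite /P !(subrr, mul0r, mulr0, mulr1, sub0r, add0r, addr0) normrN normr1 ln1 mulr0 oppr0 addr0.
lra.
Qed.

(* The upper bound cannot be read off level [0], where [ln |e|] is not bounded
   below: a good level [c] exists on average, and interlacing transfers the
   bound from [c] to [0]. *)
Lemma osc_jouk_upper al : E <= al <= 1 ->
  pi * \sum_(i < n) jouk (t 0 i / al) <= ln (al / E) + 15.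
Proof.
move=> /andP[Eal al1]; have al0 : 0 < al by exact: lt_le_trans Eal.
pose z y := al * Num.sqrt (1 - y ^+ 2).
have zi y : 0 <= y <= 1 -> 0 <= z y <= al.
  move=> y01; rewrite mulr_ge0 ?sqrtr_ge0 ?(ltW al0)//= ler_piMr ?(ltW al0)//.
  by rewrite -[leRHS]sqrtr1 ler_sqrt// lerBlDr lerDl sqr_ge0.
have zi1 y : 0 <= y <= 1 -> 0 <= z y <= 1.
  by move=> /zi /andP[-> h] /=; exact: le_trans al1.
pose x y := e (z y) / E.
have [||c c1 hc] := @exists_level R x.
- move=> y y01; apply: contM; last exact: cont_cst.
  apply: (@cont_comp _ z); last by apply: (osc_cont osc); exact: zi1.
  by apply: contZ; exact: continuous_semicircle.
- move=> y y01; rewrite normrM normfV (gtr0_norm E0) ler_pdivrMr// mul1r.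
  by apply: (osc_le osc); exact: zi1.
have [|Z [F [cF eF dF]]] := @osc_primitive c al c1; first by rewrite al0.
have : F 1 - F 0 <= ln (4 * al / E) + 5.
  apply: (hc Z F (fun y => \sum_(i < n) lnker (z y) (t c i))) => // y y01 yZ.
  have [zt dFy] := dF y y01 yZ.
  have y01' : 0 <= y <= 1 by case/andP: y01 => *; rewrite !ltW.
  have T0 : 0 < Num.sqrt (1 - y ^+ 2) by rewrite sqrtr_gt0; nra.
  have z01 : 0 < z y <= 1 by rewrite mulr_gt0//=; case/andP: (zi1 y y01').
  have [n1 n2 eq] := osc_lnker_sum c1 z01 zt.
  have xE : x y - c = (e (z y) - c * E) / E by rewrite /x; field; rewrite gt_eqF.
  split => //.
    by rewrite -subr_eq0 xE mulf_neq0// invr_neq0// gt_eqF.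
  rewrite eq xE normrM normfV (gtr0_norm E0) !ln_div ?posrE ?normr_gt0 ?mulr_gt0//.
  (* Both [z y] and [E] are at most [al], so the argument is at most [2 al + 2 E <= 4 al]. *)
  have le4 : ln `|2 * z y - e (z y) + c * E| <= ln (4 * al).
    rewrite ler_ln ?posrE ?normr_gt0 ?mulr_gt0//.
    have /andP[z0 zal] := zi y y01'.
    have := osc_le osc (zi1 y y01'); rewrite !ler_norml => /andP[l1 l2].
    have : -E <= c * E <= E by nra.
    by lra.
  by lra.
rewrite eF => U.
have c0 : -1 < (0 : R) < 1 by rewrite ltrN10 ltr01.
have := @interlacing_jouk R n a al (t 0) (t c) al0 (osc_a0 osc).
have e4 : ln (4 * al / E) = ln (al / E) + ln 2 + ln 2.
  have q : 0 < al / E by rewrite divr_gt0.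
  have -> : 4 * al / E = al / E * 2 * 2 by ring.
  by move: (al / E) q => w w0; rewrite !lnM ?posrE ?mulr_gt0.
move=> /(_ (fun i => conj (osc_itv osc i c0) (osc_itv osc i c1))) D.
(* The constant 15 is 5 from the choice of level, [2 ln 2 <= 2] from the factor 4, and [2 pi <= 8]
   from interlacing. *)
have p4 : pi <= 4 :> R by have := pihalf_lt2 R; lra.
have := ler_wpM2l (pi_ge0 R) D; have := @ln2_le1 R; rewrite e4 in U.
by rewrite mulrBr; lra.
Qed.
Lemma ler_sum_but_two m (f g : 'I_m -> R) (C : R) : 0 <= C ->
  (forall i : 'I_m, (1 < i)%N -> f i <= g i) -> (forall i, f i <= C) ->
  (forall i, 0 <= g i) -> \sum_(i < m) f i <= \sum_(i < m) g i + 2 * C.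
Proof.
case: m f g => [|[|m]] f g C0 fg fC g0.
- by rewrite !big_ord0; lra.
- by rewrite !big_ord1; have := fC ord0; have := g0 ord0; lra.
rewrite !big_ord_recl /=; set k1 := lift _ _.
have h : \sum_(i < m) f (lift ord0 (lift ord0 i)) <=
    \sum_(i < m) g (lift ord0 (lift ord0 i)).
  by apply: ler_sum => i _; apply: fg.
by have := fC ord0; have := g0 ord0; have := fC k1; have := g0 k1; lra.
Qed.

Lemma osc_sum_t : `|pi * \sum_(i < n) t 0 i - ln E^-1| <= 15.
Proof.
have c1 : -1 < (0 : R) < 1 by rewrite ltrN10 ltr01.
have := @osc_jouk_lower 1; have := @osc_jouk_upper 1; rewrite lexx E1 div1r.
have -> : \sum_(i < n) jouk (t 0 i / 1) = \sum_(i < n) t 0 i.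
  apply: eq_bigr => i _; rewrite divr1 jouk_le1//.
  by have /andP[? ?] := osc_t_itv i c1; rewrite !ltW.
by move=> /(_ isT) h1 /(_ isT) h2; rewrite ler_norml; lra.
Qed.

(** [Q] is a primitive of [A al / al], and [Q 1 = n pi / 2 - T]. It remains to bound [Q E]: the
    points below [E], each costing a constant, are at most two by hypothesis, and the others are
    controlled by the bound on [A E]. *)
Lemma osc_count : (forall i : 'I_n, (1 < i)%N -> E <= t 0 i) ->
  `|n%:R * pi ^+ 2 - (ln E^-1) ^+ 2| <= 32 * ln E^-1 + 200.
Proof.
move=> tE; have c1 : -1 < (0 : R) < 1 by rewrite ltrN10 ltr01.
have ti i : 0 < t 0 i < 1 by exact: osc_t_itv.
have t0 i : 0 < t 0 i by case/andP: (ti i).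
pose Q al := \sum_(i < n) jouk_prim (t 0 i) al.
pose A al := \sum_(i < n) jouk (t 0 i / al).
pose Z := [seq t 0 i | i <- enum 'I_n].
have cQ al : E <= al <= 1 -> {for al, continuous Q}.
  move=> /andP[h _]; apply: cont_sum => i; apply: continuous_jouk_prim => //.
  exact: lt_le_trans h.
have dQ al : E < al < 1 -> al \notin Z -> is_derive al 1 Q (A al / al).
  move=> /andP[h _] aZ; rewrite /A mulr_suml; apply: is_derive1_sum => i.
  have al0 := lt_trans E0 h.
  apply: is_derive1_jouk_prim => //; apply: contraNneq aZ => ->.
  by apply/mapP; exists i; rewrite ?mem_enum.
(* A primitive of [(ln (al / E) + k) / al]; the bounds on [pi * A al] correspond to [k = -1] and
   [k = 15]. *)
pose P (k al : R) := 2^-1 * (ln `|al / E|) ^+ 2 + k * ln `|al|.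
have cP k al : E <= al <= 1 -> {for al, continuous (P k)}.
  move=> /andP[h _]; have al0 := lt_le_trans E0 h.
  apply: contD; apply: contZ; last by apply: cont_lnabs; [rewrite gt_eqF|exact: cont_id].
  apply: (@cont_comp _ (fun al => ln `|al / E|) (fun x => x ^+ 2)); last exact: exprn_continuous.
  apply: cont_lnabs; first by rewrite gt_eqF// divr_gt0.
  by apply: contM; [exact: cont_id|exact: cont_cst].
have dP k al : E < al -> is_derive al 1 (P k) ((ln (al / E) + k) / al).
  move=> h; have al0 := lt_trans E0 h.
  have aE0 : 0 < al / E by rewrite divr_gt0.
  have i := is_derive1_id al.
  have En : E != 0 by rewrite gt_eqF.
  have an : al != 0 by rewrite gt_eqF.
  have d1 := is_derive1_lnabs (is_derive1_div i (is_derive1_const E al) En) (lt0r_neq0 aE0).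
  have d2 := is_derive1_lnabs i an.
  apply: (is_derive_eq (is_derive1D (is_derive1_Zl 2^-1 (is_derive1_sqr d1)) (is_derive1_Zl k d2))).
  rewrite (gtr0_norm aE0); by field; rewrite En an.
have PE k : P k E = k * ln E.
  by rewrite /P divff ?gt_eqF// normr1 ln1 expr0n mulr0 add0r gtr0_norm.
have P1 k : P k 1 = 2^-1 * (ln E^-1) ^+ 2.
  by rewrite /P div1r normr1 ln1 mulr0 addr0 gtr0_norm ?invr_gt0.
have lnE : ln E = - ln E^-1 by rewrite lnV ?posrE// opprK.
have lo : pi * Q E - P (-1) E <= pi * Q 1 - P (-1) 1.
  apply: (@le_derive_off_finite _ Z (fun al => pi * Q al - P (-1) al)
     (fun al => pi * (A al / al) - (ln (al / E) + -1) / al)) => //.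
  - apply: within_continuous_itv => al h.
    by apply: contB; [apply: contZ; exact: cQ|exact: cP].
  - move=> al h aZ; apply: (is_derive1B (is_derive1_Zl pi (dQ al h aZ)) (dP _ _ _)).
    by case/andP: h.
  - move=> al /andP[h1 h2] _; have al0 := lt_trans E0 h1.
    rewrite mulrA -mulrBl divr_ge0 ?(ltW al0)// subr_ge0.
    by apply: osc_jouk_lower; rewrite !ltW.
have up : P 15 E - pi * Q E <= P 15 1 - pi * Q 1.
  apply: (@le_derive_off_finite _ Z (fun al => P 15 al - pi * Q al)
     (fun al => (ln (al / E) + 15) / al - pi * (A al / al))) => //.
  - apply: within_continuous_itv => al h.
    by apply: contB; [exact: cP|apply: contZ; exact: cQ].
  - move=> al h aZ; apply: (is_derive1B (dP _ _ _) (is_derive1_Zl pi (dQ al h aZ))).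
    by case/andP: h.
  - move=> al /andP[h1 h2] _; have al0 := lt_trans E0 h1.
    rewrite mulrA -mulrBl divr_ge0 ?(ltW al0)// subr_ge0.
    by apply: osc_jouk_upper; rewrite !ltW.
have Q1 : Q 1 = n%:R * (pi / 2) - \sum_(i < n) t 0 i.
  rewrite -[n in n%:R]card_ord -sumr_const mulr_suml -sumrB; apply: eq_bigr => i _.
  have /andP[h0 h1] := ti i; rewrite mul1r /jouk_prim div1r divr1 jouk_le1 ?ltW//.
  congr (_ - _); rewrite -asinc1; congr asinc.
  have h : 1 <= (t 0 i)^-1 by rewrite invf_ge1// ltW.
  by rewrite /clamp01 !ger0_norm ?subr_ge0//; lra.
have AE : pi * A E <= 15.
  have := @osc_jouk_upper E; rewrite lexx E1 divff ?gt_eqF// ln1 add0r.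
  by apply.
have A0 : 0 <= A E.
  by apply: sumr_ge0 => i _; apply: jouk_ge0; rewrite divr_ge0// ltW.
have QE0 : - A E <= Q E.
  rewrite -sumrN; apply: ler_sum => i _; rewrite lerDr.
  by apply: asinc_ge0; case/andP: (clamp01_itv (E / t 0 i)).
have QE1 : Q E <= 2 * 2 + 4 * A E.
  have h0 : 2 * 2 + 4 * A E = \sum_(i < n) 4 * jouk (t 0 i / E) + 2 * 2.
    by rewrite mulr_sumr addrC.
  rewrite h0; have jE i : 0 <= jouk (t 0 i / E) by apply: jouk_ge0; rewrite divr_ge0// ltW.
  (* For [t >= E], [asinc (E / t) <= 2 E / t] and [E / t <= 2 jouk (t / E)]. *)
  have big (i : 'I_n) : (1 < i)%N -> jouk_prim (t 0 i) E <= 4 * jouk (t 0 i / E).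
    move=> i0; have Eti := tE i i0.
    have s1 : 1 <= t 0 i / E by rewrite ler_pdivlMr// mul1r.
    have := jouk_lb s1; rewrite invf_div => h.
    rewrite /jouk_prim clamp01_id; last first.
      by rewrite divr_ge0 ?(ltW E0) ?(ltW (t0 i))//= ler_pdivrMr// mul1r.
    have : 0 <= E / t 0 i by rewrite divr_ge0// ltW.
    by move/asinc_le; have := jE i; lra.
  have small i : jouk_prim (t 0 i) E <= 2.
    have /andP[k0 k1] := clamp01_itv (E / t 0 i).
    by have := asinc_le k0; have := jE i; rewrite /jouk_prim; lra.
  by apply: ler_sum_but_two => // i; rewrite mulr_ge0.
have := osc_sum_t; have := @pi_ge2 R; have p4 : pi <= 4 :> R by have := pihalf_lt2 R; lra.
have L0 : 0 <= ln E^-1 by rewrite ln_ge0// invf_ge1.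
have QE0' := ler_wpM2l (pi_ge0 R) QE0.
have QE1' := ler_wpM2l (pi_ge0 R) QE1.
move: lo up; rewrite !PE !P1 Q1 lnE mulrBr => lo up p2.
rewrite !ler_norml => /andP[T1 T2].
(* The coefficient 32 is [2 (15 + 1)]: 15 from [P 15 E], and 1 from [pi T <= ln E^-1 + 15]. *)
have -> : n%:R * pi ^+ 2 = 2 * (pi * (n%:R * (pi / 2))) :> R by field.
move: QE0' QE1'; rewrite mulrN mulrDr.
have -> : pi * (4 * A E) = 4 * (pi * A E) by ring.
by move=> q0 q1; apply/andP; split; lra.
Qed.

End Oscillation.

(** * Alternation points or a separating polynomial *)

Section Alternation.
Context {R : realType}.
Implicit Types (f : R -> R) (E u v x t : R) (s : {poly R}) (a : nat -> R).

Definition alternates f E k a :=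
  [/\ 0 <= a 0%N, `|f (a 0%N)| = E & forall i, (i < k)%N ->
    a i < a i.+1 /\ f (a i.+1) = - f (a i)].

Lemma alternates_norm f E k a i : alternates f E k a -> (i <= k)%N -> `|f (a i)| = E.
Proof.
by move=> [_ h0 h]; elim: i => // i IH ik; have [_ ->] := h i ik; rewrite normrN IH// ltnW.
Qed.

Lemma alternates_ge0 f E k a i : alternates f E k a -> (i <= k)%N -> 0 <= a i.
Proof.
move=> [h0 _ h]; elim: i => // i IH ik; have [/ltW lt _] := h i ik.
by rewrite (le_trans (IH (ltnW ik))).
Qed.

Lemma alternates_leq f E k l a : alternates f E k a -> (l <= k)%N -> alternates f E l a.
Proof. by move=> [h0 h1 h] lk; split => // i il; apply: h; exact: leq_trans lk. Qed.

Lemma alternates_le f E k a i j : alternates f E k a -> (i <= j <= k)%N -> a i <= a j.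
Proof.
move=> [_ _ h] /andP[]; elim: j => [|j IH]; first by rewrite leqn0 => /eqP ->.
rewrite leq_eqVlt => /predU1P[-> //|ij] jk; have [/ltW lt _] := h j jk.
by rewrite (le_trans (IH _ (ltnW jk))).
Qed.

(* [s] separates the extremal points of opposite signs of [f] in [0, u]; its
   sign beyond [u] is that of the last alternation point. *)
Definition separated f E u :=
  (forall t, 0 <= t <= u -> `|f t| != E) \/
  exists k a s, [/\ alternates f E k a, a k <= u, (size s <= k.+1)%N,
    (forall t, 0 <= t <= u -> `|f t| = E -> 0 < f t * s.[t ^+ 2]) &
    (forall x, u <= x -> 0 < s.[x ^+ 2] * f (a k))].

(** Since [f] varies by less than [2 E] on [u, v], its extremal points there share one sign. If that
    sign is new, one alternation point is added and [s] gets the root [u^2]; otherwise [s] is kept.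
    Everything is polynomial in [t^2], the variable of the approximant. *)
Lemma separated_extend f E u v : 0 < E -> 0 <= u -> u <= v ->
  (forall x y, u <= x <= v -> u <= y <= v -> `|f x - f y| < 2 * E) ->
  separated f E u -> separated f E v.
Proof.
move=> E0 u0; rewrite le_eqVlt => /predU1P[-> //|uv] osc.
have same x y : u <= x <= v -> u <= y <= v -> `|f x| = E -> `|f y| = E -> f x = f y.
  move=> hx hy ex ey; have := osc x y hx hy; rewrite ltr_norml.
  by move: ex ey; case: (ger0P (f x)); case: (ger0P (f y)) => *; lra.
case=> [none|[k [a [s [alt aku ss S1 S2]]]]].
- have [[y [yi ye]]|nex] := pselect (exists y, u <= y <= v /\ `|f y| = E).
    right; exists 0%N, (fun=> y), (f y)%:P; split.
    + by split => //; case/andP: yi => h _; exact: le_trans h.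
    + by case/andP: yi.
    + by rewrite (leq_trans (size_polyC_leq1 _)).
    + move=> t /andP[t0 tv] te; rewrite hornerC.
      have [tu|ut] := leP t u; first by have := none t; rewrite t0 tu te eqxx => /(_ isT).
      rewrite (same t y) ?(ltW ut)// -expr2 -real_normK ?num_real// ye exprn_gt0//.
    + by move=> x _; rewrite hornerC -expr2 -real_normK ?num_real// ye exprn_gt0.
  left=> t /andP[t0 tv]; apply/eqP => te.
  have [tu|ut] := leP t u; first by have := none t; rewrite t0 tu te eqxx => /(_ isT).
  by apply: nex; exists t; rewrite (ltW ut) tv.
- have fk := alternates_norm alt (leqnn k).
  have [[y [yi ye]]|nex] := pselect (exists y, u <= y <= v /\ f y = - f (a k)).
    have yE : `|f y| = E by rewrite ye normrN.
    (* The new root must not hit an extremal point: at [u] the sign would have to be both that of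
       [f (a k)] and that of [f y]. *)
    have uS : `|f u| != E.
      apply/eqP => ue; have := S1 u; rewrite u0 lexx => /(_ isT ue).
      have := S2 u (lexx u).
      have e1 : f u = f y by apply: same => //; rewrite lexx ltW.
      by rewrite e1 ye mulNr oppr_gt0 mulrC; lra.
    right; exists k.+1, (fun i => if (i <= k)%N then a i else y), (s * ((u ^+ 2)%:P - 'X)).
    have aky : a k < y.
      case/andP: yi => uy _; rewrite lt_neqAle (le_trans aku uy) andbT.
      apply/eqP => aky; move: ye fk; rewrite -aky => e1.
      have -> : f (a k) = 0 by lra.
      by rewrite normr0 => e0; rewrite -e0 ltxx in E0.
    case: alt => alt0 alt1 alt2; split.
    + split => // i; rewrite ltnS => ik; rewrite ik.
      move: ik; rewrite leq_eqVlt => /predU1P[->|ik]; first by rewrite ltnn.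
      by rewrite ik; exact: alt2.
    + by rewrite ltnn; case/andP: yi.
    + have sz : size ((u ^+ 2)%:P - 'X) = 2%N by rewrite -opprB size_polyN size_XsubC.
      by rewrite (leq_trans (size_polyMleq _ _))// sz addn2.
    + move=> t /andP[t0 tv] te; rewrite hornerM hornerD hornerN hornerX hornerC mulrA.
      have [tu|ut] := leP t u.
        rewrite mulr_gt0//; first by apply: S1 => //; rewrite t0.
        have : t < u by rewrite lt_neqAle tu andbT; apply: contra_neq uS => <-.
        by nra.
      have ty : f t = f y by apply: same => //; rewrite tv ltW.
      have := S2 t (ltW ut); rewrite ty ye.
      have : u ^+ 2 - t ^+ 2 < 0 by nra.
      by move: (s.[_]) (f (a k)) => p q h1 h2; nra.
    + move=> x vx; rewrite ltnn hornerM hornerD hornerN hornerX hornerC ye.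
      have ux := lt_le_trans uv vx.
      have := S2 x (ltW ux).
      have : u ^+ 2 - x ^+ 2 < 0 by nra.
      by move: (s.[_]) (f (a k)) => p q h1 h2; nra.
  right; exists k, a, s; split => //.
  + exact: le_trans (ltW uv).
  + move=> t /andP[t0 tv] te; have [tu|ut] := leP t u; first by apply: S1 => //; rewrite t0.
    have -> : f t = f (a k).
      have nt : f t <> - f (a k) by move=> h; apply: nex; exists t; rewrite (ltW ut) tv.
      by move: te fk nt; case: (ger0P (f t)); case: (ger0P (f (a k))) => *; lra.
    by rewrite mulrC; exact: S2 (ltW ut).
  + by move=> x vx; apply: S2; exact: le_trans (ltW uv) vx.
Qed.

(** Continuous induction: near the supremum [w] of the good [u], [f] stays within [E] of [f w], so
    [separated_extend] passes from a good point just below [w] to one beyond it, or to 1. *)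
Lemma separated1 f E : 0 < E -> (forall t, 0 <= t <= 1 -> {for t, continuous f}) ->
  separated f E 1.
Proof.
move=> E0 cf.
have near0 t : 0 <= t <= 1 -> exists2 d, 0 < d & forall x, `|t - x| < d -> `|f t - f x| < E.
  move=> /cf/cvgrPdist_lt/(_ E E0)/nbhs_ballP[d /= d0 h].
  by exists d => // x tx; exact: h.
have ext t d u v : (forall x, `|t - x| < d -> `|f t - f x| < E) ->
    0 <= u -> u <= v -> t - d < u -> v < t + d -> separated f E u -> separated f E v.
  move=> h u0 uv tu vt; apply: separated_extend => // x y /andP[ux xv] /andP[uy yv].
  have hx : `|f t - f x| < E by apply: h; rewrite ltr_norml; lra.
  have hy : `|f t - f y| < E by apply: h; rewrite ltr_norml; lra.
  by move: hx hy; rewrite !ltr_norml; lra.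
pose A := [set u | 0 <= u <= 1 /\ separated f E u].
have A0 : A 0.
  split; first by rewrite lexx ler01.
  have [e0|n0] := eqVneq `|f 0| E; last first.
    by left=> t t0; rewrite (_ : t = 0)//; lra.
  right; exists 0%N, (fun=> 0), (f 0)%:P; split => //.
  - by rewrite (leq_trans (size_polyC_leq1 _)).
  - move=> t t0 _; rewrite (_ : t = 0); last lra.
    by rewrite hornerC -expr2 -real_normK ?num_real// e0 exprn_gt0.
  - by move=> x _; rewrite hornerC -expr2 -real_normK ?num_real// e0 exprn_gt0.
have hsA : has_sup A.
  by split; [exists 0|exists 1 => u [/andP[]]].
pose w := sup A.
have w0 : 0 <= w by apply: ub_le_sup => //; case: hsA.
have w1 : w <= 1 by apply: ge_sup; [exists 0|move=> u [/andP[]]].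
have [d d0 hd] : exists2 d, 0 < d & forall x, `|w - x| < d -> `|f w - f x| < E.
  by apply: near0; rewrite w0.
have [u [/andP[u0 u1] Su] wu] := sup_adherent d0 hsA.
have uw : u <= w by apply: ub_le_sup; [case: hsA|split => //; rewrite u0].
have Sw' : separated f E (Num.min 1 (w + d / 2)).
  apply: (ext w d u) => //.
  - by rewrite le_min u1; rewrite (le_trans uw)//; lra.
  - by rewrite (le_lt_trans (y := w + d / 2))// ?ge_min ?lexx ?orbT//; lra.
have [h|h] := leP 1 (w + d / 2); first by rewrite min_l in Sw'.
have : w + d / 2 <= w.
  apply: ub_le_sup; first by case: hsA.
  split; first by apply/andP; split; lra.
  by rewrite min_r ?ltW// in Sw'.
by lra.
Qed.

Lemma alternation_or_separation f E m : 0 < E ->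
  (forall t, 0 <= t <= 1 -> {for t, continuous f}) ->
  (exists2 a, alternates f E m.+1 a & a m.+1 <= 1) \/
  exists2 s : {poly R}, (size s <= m.+1)%N &
    forall t, 0 <= t <= 1 -> `|f t| = E -> 0 < f t * s.[t ^+ 2].
Proof.
move=> E0 cf; have [none|[k [a [s [alt ak1 ss S1 _]]]]] := separated1 E0 cf.
  right; exists 1; first by rewrite size_poly1.
  by move=> t t01 te; have := none t t01; rewrite te eqxx.
have [mk|km] := ltnP m k.
  left; exists a; first exact: alternates_leq alt mk.
  by rewrite (le_trans _ ak1)//; apply: (alternates_le alt); rewrite mk leqnn.
right; exists s => //; exact: leq_trans ss _.
Qed.

End Alternation.

(** * A separating polynomial yields a better approximant *)

Section Perturbation.
Context {R : realType}.
Implicit Types (p q s u v : {poly R}) (pq : {poly R} * {poly R}) (t E M : R).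

Definition sqrt_err pq t : R := t - pq.1.[t ^+ 2] / pq.2.[t ^+ 2].

Lemma sqr_itv t : 0 <= t <= 1 -> 0 <= t ^+ 2 <= 1.
Proof. by move=> /andP[t0 t1]; rewrite sqr_ge0 exprn_ile1. Qed.

Lemma err_leP pq M :
  err_le pq M <-> forall t, 0 <= t <= 1 -> `|sqrt_err pq t| <= M.
Proof.
split=> [h t t01|h x x01].
  have := h _ (sqr_itv t01); rewrite sqrtr_sqr.
  by have /andP[t0 _] := t01; rewrite (ger0_norm t0).
have /andP[x0 x1] := x01.
have := h (Num.sqrt x); rewrite /sqrt_err sqr_sqrtr// sqrtr_ge0.
rewrite -[X in _ && (_ <= X)]sqrtr1 ler_sqrt// x1.
by apply.
Qed.

Lemma continuous_horner_sqr p t : {for t, continuous (fun t => p.[t ^+ 2])}.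
Proof.
apply: (@cont_comp _ (fun t => t ^+ 2) (horner p)); first exact: exprn_continuous.
exact: continuous_horner.
Qed.

Lemma continuous_sqrt_err N pq t : admissible N pq -> 0 <= t <= 1 ->
  {for t, continuous (sqrt_err pq)}.
Proof.
move=> [_ [_ q0]] t01; apply: contB; first exact: cont_id.
apply: cont_div; [exact: q0 _ (sqr_itv t01)|exact: continuous_horner_sqr..].
Qed.

Lemma max_on_itv (f : R -> R) : (forall t, 0 <= t <= 1 -> {for t, continuous f}) ->
  exists2 t, 0 <= t <= 1 & forall x, 0 <= x <= 1 -> f x <= f t.
Proof.
move=> cf; have [c] := EVT_max ler01 (within_continuous_itv cf).
by rewrite in_itv/= => c01 h; exists c => // x x01; apply: h.
Qed.

Lemma bounded_on_itv (f : R -> R) : (forall t, 0 <= t <= 1 -> {for t, continuous f}) ->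
  exists2 M, 0 < M & forall t, 0 <= t <= 1 -> `|f t| <= M.
Proof.
move=> cf; have [|t t01 h] := @max_on_itv (fun t => `|f t|).
  by move=> t t01; apply: (cont_comp (cf t t01)); exact: norm_continuous.
exists (`|f t| + 1); first by rewrite ltr_wpDl.
by move=> x x01; rewrite (le_trans (h x x01))// lerDl.
Qed.

Lemma min_gt0_on_itv (f : R -> R) : (forall t, 0 <= t <= 1 -> {for t, continuous f}) ->
  (forall t, 0 <= t <= 1 -> 0 < f t) ->
  exists2 m, 0 < m & forall t, 0 <= t <= 1 -> m <= f t.
Proof.
move=> cf f0; have [|t t01 h] := @max_on_itv (fun t => 0 - f t).
  by move=> t t01; apply: contB; [exact: cont_cst|exact: cf].
by exists (f t); [exact: f0|move=> x /h; rewrite !sub0r lerN2].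
Qed.

Lemma sqrt_err_max N pq : admissible N pq ->
  exists t, [/\ 0 <= t <= 1, err_le pq `|sqrt_err pq t| &
    forall x, 0 <= x <= 1 -> `|sqrt_err pq x| <= `|sqrt_err pq t|].
Proof.
move=> ad; have [|t t01 h] := @max_on_itv (fun t => `|sqrt_err pq t|).
  by move=> t t01; apply: (cont_comp (continuous_sqrt_err ad t01)); exact: norm_continuous.
by exists t; split => //; apply/err_leP.
Qed.

(** The first-order variations of [p / q] have numerators [u q - v p]; coprimality makes these fill
    all degrees up to [N + D]. Reducing the cofactor of [p] modulo [q] bounds its degree, and the
    equation then bounds that of [u]. *)
Lemma bezout_size p q s N D : coprimep p q -> size q = D.+1 -> (size p <= D.+1)%N ->
  (D <= N)%N -> (size s <= (N + D).+1)%N ->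
  exists u v, [/\ (size u <= N.+1)%N, (size v <= N.+1)%N & u * q - v * p = s].
Proof.
move=> /Bezout_eq1_coprimepP[[b1 b2] /= b] sq sp DN ss.
have q0 : q != 0 by rewrite -size_poly_gt0 sq.
pose w := (s * b1) %% q; pose u := s * b2 + (s * b1) %/ q * p.
have e : u * q + w * p = s.
  transitivity (s * b2 * q + ((s * b1) %/ q * q + (s * b1) %% q) * p).
    by rewrite /u /w; ring.
  rewrite -divp_eq; transitivity (s * (b1 * p + b2 * q)); first by ring.
  by rewrite b mulr1.
have sw : (size w <= D)%N by rewrite -ltnS -sq ltn_modp.
exists u, (- w); rewrite size_polyN mulNr opprK; split => //.
- have [->|u0] := eqVneq u 0; first by rewrite size_poly0.
  have : (size (u * q)%R <= (N + D).+1)%N.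
    have -> : u * q = s - w * p by rewrite -e addrK.
    rewrite (leq_trans (size_polyD _ _))// geq_max ss size_polyN.
    apply: leq_trans (size_polyMleq _ _) _.
    by move: (size w) (size p) sw sp => x y; lia.
  rewrite size_mul// sq addnS/=.
  by move: (size u) => x; lia.
- by rewrite (leq_trans sw)// ltnW.
Qed.

(** Moving to [(p + ep u) / (q + ep v)] with [u q - v p = s] subtracts [ep s / (q q')] from the
    error, where [q'] is the new denominator. This shrinks the error on the extremal set, where [s]
    has its sign, and by compactness everywhere for small [ep]. *)
Lemma best_no_separation N D pq s E : best_approx N pq ->
  0 < E -> (forall t, 0 <= t <= 1 -> `|sqrt_err pq t| <= E) ->
  (exists2 t, 0 <= t <= 1 & `|sqrt_err pq t| = E) ->
  maxn (size pq.1) (size pq.2) = D.+1 -> (size s <= (N + D).+1)%N ->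
  ~ (forall t, 0 <= t <= 1 -> `|sqrt_err pq t| = E ->
       0 < sqrt_err pq t * s.[t ^+ 2]).
Proof.
move=> [ad [cop best]] E0 leE [t0 t001 t0E] sD ss sep.
have [sp [sq qn0]] := ad; rewrite /deg_le in sp sq.
have DN : (D <= N)%N by rewrite -ltnS -sD geq_max sp.
have [u [v [su sv suv]]] : exists u v, [/\ (size u <= N.+1)%N, (size v <= N.+1)%N &
    u * pq.2 - v * pq.1 = s].
  (* The modulus in [bezout_size] must have degree exactly [D]; when only the numerator does, the
     roles are exchanged and [s] changes sign. *)
  have [pq'|qp'] := leqP (size pq.1) (size pq.2).
    by apply: (@bezout_size _ _ _ _ D) => //; rewrite -sD ?leq_maxl//; apply/esym/maxn_idPr.
  have [|||||u [v [? ? e]]] := @bezout_size pq.2 pq.1 (- s) N D.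
  - by rewrite coprimep_sym.
  - by rewrite -sD; apply/esym/maxn_idPl/ltnW.
  - by rewrite -sD leq_maxr.
  - by [].
  - by rewrite size_polyN.
  by exists v, u; split => //; rewrite -opprB e opprK.
pose e := sqrt_err pq.
have ce t : 0 <= t <= 1 -> {for t, continuous e}.
  exact: continuous_sqrt_err ad.
have cs' t : 0 <= t <= 1 -> {for t, continuous (fun t => e t * s.[t ^+ 2])}.
  by move=> t01; apply: contM; [exact: ce|exact: continuous_horner_sqr].
(* Positive everywhere: the first part off the extremal set, the second on it. Its minimum [m] shows
   that either the slack [E - |e|] is at least [m / 2] or [e s > m / 4]. *)
pose g t := (E - `|e t|) + (`|e t * s.[t ^+ 2]| + e t * s.[t ^+ 2]).
have [||m m0 hm] := @min_gt0_on_itv g.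
- move=> t t01; apply: contD.
    apply: contB; first exact: cont_cst.
    by apply: (cont_comp (ce t t01)); exact: norm_continuous.
  apply: contD; last exact: cs'.
  by apply: (cont_comp (cs' t t01)); exact: norm_continuous.
- move=> t t01; rewrite /g.
  have h1 := leE t t01; have h2 := ler_norm (- (e t * s.[t ^+ 2])); rewrite normrN in h2.
  have [eE|nE] := eqVneq `|e t| E.
    by have := sep t t01 eE; rewrite -/(e t) => h; have := normr_ge0 (e t * s.[t ^+ 2]); lra.
  have : `|e t| < E by rewrite lt_neqAle nE.
  by lra.
have [||Q0 Q00 hQ0] := @min_gt0_on_itv (fun t => `|pq.2.[t ^+ 2]|).
- move=> t _; apply: (@cont_comp _ (fun t => pq.2.[t ^+ 2])); first exact: continuous_horner_sqr.
  exact: norm_continuous.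
- by move=> t t01; rewrite normr_gt0 qn0// sqr_itv.
have [|V V0 hV] := @bounded_on_itv (fun t => v.[t ^+ 2]).
  by move=> t _; exact: continuous_horner_sqr.
have [|S S0 hS] := @bounded_on_itv (fun t => s.[t ^+ 2]).
  by move=> t _; exact: continuous_horner_sqr.
(* The three bounds keep the new denominator away from 0, the shift [w |s|] below the slack, and the
   quadratic term [w s^2] below [e s]. *)
pose ep := Num.min (Q0 / (2 * V)) (Num.min (m * Q0 ^+ 2 / (8 * S)) (m * Q0 ^+ 2 / (8 * S ^+ 2))).
have ep0 : 0 < ep by rewrite !lt_min !(divr_gt0, mulr_gt0, exprn_gt0)//.
have epV : ep * V <= Q0 / 2.
  rewrite -ler_pdivlMr// (le_trans (_ : _ <= Q0 / (2 * V))) ?ge_min ?lexx//.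
  by rewrite invfM mulrA.
have epS : ep * (8 * S) <= m * Q0 ^+ 2.
  by rewrite -ler_pdivlMr ?mulr_gt0// !ge_min lexx orbT.
have epS2 : ep * (8 * S ^+ 2) <= m * Q0 ^+ 2.
  by rewrite -ler_pdivlMr ?mulr_gt0 ?exprn_gt0// !ge_min lexx !orbT.
pose pq' := (pq.1 + ep *: u, pq.2 + ep *: v).
have hq t : 0 <= t <= 1 ->
    Q0 ^+ 2 / 2 <= pq.2.[t ^+ 2] * pq'.2.[t ^+ 2].
  move=> t01; rewrite /= hornerD hornerZ.
  have := hQ0 t t01; have := hV t t01; move: (pq.2.[_]) (v.[_]) => a b vb Qa.
  have : `|ep * b| <= Q0 / 2.
    by rewrite normrM (gtr0_norm ep0) (le_trans _ epV)// ler_pM2l.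
  rewrite ler_norml => /andP[b1 b2].
  by move: Qa; case: (ger0P a) => a0 Qa; nra.
have hq0 t : 0 <= t <= 1 -> pq'.2.[t ^+ 2] != 0.
  move=> t01; have := hq t t01; apply: contraTneq => ->; rewrite mulr0 -ltNge.
  by rewrite divr_gt0// exprn_gt0.
have ad' : admissible N pq'.
  split; [|split].
  - rewrite /deg_le/= (leq_trans (size_polyD _ _))// geq_max sp.
    by rewrite (leq_trans (size_scale_leq _ _)).
  - rewrite /deg_le/= (leq_trans (size_polyD _ _))// geq_max sq.
    by rewrite (leq_trans (size_scale_leq _ _)).
  - move=> x /andP[x0 x1]; have := hq0 (Num.sqrt x); rewrite sqr_sqrtr//; apply.
    by rewrite sqrtr_ge0 -[X in _ && (_ <= X)]sqrtr1 ler_sqrt.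
have lt t : 0 <= t <= 1 -> `|sqrt_err pq' t| < E.
  move=> t01.
  pose w := ep / (pq.2.[t ^+ 2] * pq'.2.[t ^+ 2]).
  have e' : sqrt_err pq' t = e t - w * s.[t ^+ 2].
    have q1 := qn0 _ (sqr_itv t01); have q2 := hq0 _ t01.
    rewrite /w -suv; move: q2; rewrite /e /sqrt_err /= !(hornerE, hornerZ) => q2.
    by field; rewrite q1 q2.
  have K0 : 0 < pq.2.[t ^+ 2] * pq'.2.[t ^+ 2].
    by apply: lt_le_trans (hq t t01); rewrite divr_gt0// exprn_gt0.
  have w0 : 0 < w by rewrite divr_gt0.
  have w2 : w * (Q0 ^+ 2 / 2) <= ep.
    by rewrite /w mulrAC ler_pdivrMr// ler_pM2l// hq.
  have Q2 : 0 < Q0 ^+ 2 by rewrite exprn_gt0.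
  have wS : w * S <= m / 4.
    have : w * S * Q0 ^+ 2 <= m / 4 * Q0 ^+ 2 by nra.
    by rewrite ler_pM2r.
  have wS2 : w * S ^+ 2 <= m / 4.
    have : w * S ^+ 2 * Q0 ^+ 2 <= m / 4 * Q0 ^+ 2.
      by have := exprn_gt0 2 S0; nra.
    by rewrite ler_pM2r.
  rewrite e'; have := hm t t01; have := hS t t01; have := leE t t01; rewrite /g -/(e t).
  move: (e t) (s.[_]) => a b aE bS gm.
  have [h|h] := leP (m / 2) (E - `|a|).
    have : `|w * b| <= m / 4.
      by rewrite normrM (gtr0_norm w0) (le_trans _ wS)// ler_pM2l.
    by have := ler_normB a (w * b); lra.
  have ab : m / 4 < a * b by move: gm; case: (ger0P (a * b)) => ab0; lra.
  have b2 : b ^+ 2 <= S ^+ 2 by rewrite -real_normK ?num_real// ler_pXn2r ?nnegrE// ltW.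
  have a2 : a ^+ 2 <= E ^+ 2 by rewrite -real_normK ?num_real// ler_pXn2r ?nnegrE// ltW.
  rewrite -(ltr_pXn2r (_ : 0 < 2)%N) ?nnegrE ?(ltW E0)// real_normK ?num_real//.
  have h1 : w * b ^+ 2 <= m / 4 by rewrite (le_trans _ wS2)// ler_pM2l.
  have h2 : w * (w * b ^+ 2) <= w * (m / 4) by rewrite ler_pM2l.
  have h3 : w * (m / 4) < w * (a * b) by rewrite ltr_pM2l.
  have h4 : 0 < w * (a * b) by rewrite mulr_gt0//; lra.
  have -> : (a - w * b) ^+ 2 = a ^+ 2 - 2 * (w * (a * b)) + w * (w * b ^+ 2) by ring.
  by lra.
have [t1 [t101 le1 _]] := sqrt_err_max ad'.
have /err_leP/(_ _ t001) := best pq' ad' _ le1.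
by rewrite t0E leNgt lt.
Qed.

End Perturbation.

(** * Structure of the best approximant: full degree and located level points *)

Section Structure.
Context {R : realType}.
Implicit Types (p q : {poly R}) (pq : {poly R} * {poly R}) (t E g z : R).

(* The numerator, in the variable [t], of [sqrt_err pq t - g]. *)
Definition level_poly pq g : {poly R} :=
  'X * (pq.2 \Po 'X^2) - (pq.1 \Po 'X^2) - g *: (pq.2 \Po 'X^2).

Lemma level_polyE pq g t : (level_poly pq g).[t] =
  t * pq.2.[t ^+ 2] - pq.1.[t ^+ 2] - g * pq.2.[t ^+ 2].
Proof.
by rewrite /level_poly !hornerE !horner_comp !hornerE.
Qed.

Lemma level_poly_err pq g t : pq.2.[t ^+ 2] != 0 ->
  (level_poly pq g).[t] = pq.2.[t ^+ 2] * (sqrt_err pq t - g).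
Proof. by move=> q0; rewrite level_polyE /sqrt_err; field. Qed.

Lemma level_polyN_err pq g t : pq.2.[t ^+ 2] != 0 ->
  (level_poly pq g).[- t] = - (pq.2.[t ^+ 2] * (2 * t - sqrt_err pq t + g)).
Proof. by move=> q0; rewrite level_polyE sqrrN /sqrt_err; field. Qed.

Lemma level_poly_neq0 pq g : pq.2.[1] != 0 -> level_poly pq g != 0.
Proof.
move=> q1; apply/eqP => h0.
have := level_polyE pq g 1; have := level_polyE pq g (-1).
rewrite h0 !horner0 sqrrN expr1n => h1 h2.
by move/eqP: q1; apply; lra.
Qed.

Lemma size_comp_sqr p D : (size p <= D.+1)%N -> (size (p \Po 'X^2) <= D.*2.+1)%N.
Proof.
move=> sp; rewrite (leq_trans (size_comp_poly_leq _ _))// size_polyXn ltnS muln2.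
by rewrite leq_double; case: (size p) sp.
Qed.

Lemma size_level_poly pq g D : (size pq.1 <= D.+1)%N -> (size pq.2 <= D.+1)%N ->
  (size (level_poly pq g) <= D.*2.+2)%N.
Proof.
move=> sp sq; have cp := size_comp_sqr sp; have cq := size_comp_sqr sq.
rewrite (leq_trans (size_polyD _ _))// geq_max size_polyN.
rewrite (leq_trans (size_scale_leq _ _)) ?(leq_trans cq)// andbT.
rewrite (leq_trans (size_polyD _ _))// geq_max size_polyN (leq_trans cp)// andbT.
by rewrite (leq_trans (size_polyMleq _ _))// size_polyX.
Qed.

(** The top odd degree [2 N + 1] can only come from [t q(t^2)]. Having [2 N + 1] roots therefore
    forces [q] to have degree exactly [N]. *)
Lemma size_level_poly_lt pq g N : (size pq.1 <= N.+1)%N -> (size pq.2 <= N)%N ->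
  (size (level_poly pq g) <= N.*2.+1)%N.
Proof.
case: N => [|N] sp sq.
  move: sq; rewrite leqn0 size_poly_eq0 => /eqP q0.
  rewrite /level_poly q0 comp_poly0 mulr0 scaler0 subr0 sub0r size_polyN.
  exact: size_comp_sqr sp.
have cp := size_comp_sqr sp; have cq := size_comp_sqr sq.
rewrite (leq_trans (size_polyD _ _))// geq_max size_polyN.
rewrite (leq_trans (size_scale_leq _ _)) ?(leq_trans cq) ?ltnS ?leq_double// andbT.
rewrite (leq_trans (size_polyD _ _))// geq_max size_polyN (leq_trans cp)// andbT.
by rewrite (leq_trans (size_polyMleq _ _))// size_polyX doubleS !ltnS (leq_trans cq).
Qed.

Lemma alternates_level (f : R -> R) E k a g : alternates f E k a -> a k <= 1 ->
  (forall t, 0 <= t <= 1 -> {for t, continuous f}) -> -E < g < E ->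
  forall i : 'I_k, exists t, a i < t < a i.+1 /\ f t = g.
Proof.
move=> alt ak1 cf gE i; have [_ _ h] := alt; have [lt fi] := h i (ltn_ord i).
have a0 : 0 <= a i by apply: (alternates_ge0 alt); exact: ltnW.
have a1 : a i.+1 <= 1.
  by rewrite (le_trans _ ak1)//; apply: (alternates_le alt); rewrite leqnn andbT.
have nE := alternates_norm alt (ltnW (ltn_ord i)).
have cw : {within `[a i, a i.+1], continuous f}.
  apply: within_continuous_itv => x /andP[x0 x1]; apply: cf.
  by rewrite (le_trans a0 x0) (le_trans x1 a1).
have v : f (a i) = E \/ f (a i) = - E.
  by move: nE; case: (ger0P (f (a i))) => _ h'; [left|right]; lra.
have [|c ci fc] := IVT (ltW lt) cw (v := g).
  by rewrite fi ge_min le_max; case: v => ->; apply/andP; split; apply/orP; lra.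
exists c; split => //; move: ci; rewrite in_itv/= => /andP[c0 c1].
rewrite !lt_neqAle c0 c1 !andbT; apply/andP; split; apply/eqP => hc.
  by move: fc; rewrite -hc; case: v => ->; lra.
by move: fc; rewrite hc fi; case: v => ->; lra.
Qed.

Lemma ordered_roots_prod (h : {poly R}) k (a : nat -> R) (t : 'I_k -> R) : h != 0 ->
  (forall i : 'I_k, a i < t i < a i.+1 /\ root h (t i)) ->
  (k < size h)%N /\ (size h = k.+1 ->
    h = lead_coef h *: \prod_(i < k) ('X - (t i)%:P)).
Proof.
move=> h0 ht.
have am (i j : nat) : (i <= j <= k)%N -> a i <= a j.
  move=> /andP[]; elim: j => [|j IH]; first by rewrite leqn0 => /eqP ->.
  rewrite leq_eqVlt => /predU1P[-> //|ij] jk.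
  have [/andP[l1 l2] _] := ht (Ordinal jk).
  by rewrite (le_trans (IH ij (ltnW jk)))// (le_trans (ltW l1))// ltW.
have tlt (i j : 'I_k) : (i < j)%N -> t i < t j.
  move=> ij; have [/andP[_ l2] _] := ht i; have [/andP[l1 _] _] := ht j.
  rewrite (lt_le_trans l2)// (le_trans _ (ltW l1))//.
  by apply: am; rewrite ij ltnW.
have tinj : injective t.
  move=> i j e; apply/val_inj/eqP; case: (ltngtP i j) => // /tlt; rewrite e ltxx//.
pose rs := [seq t i | i <- enum 'I_k].
have urs : uniq rs by rewrite map_inj_uniq ?enum_uniq.
have ars : all (root h) rs by apply/allP => _ /mapP[i _ ->]; have [] := ht i.
have srs : size rs = k by rewrite size_map size_enum_ord.
split; first by have := max_poly_roots h0 ars urs; rewrite srs.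
move=> sh; rewrite {1}(all_roots_prod_XsubC _ ars); last 2 first.
- by rewrite sh srs.
- by rewrite uniq_rootsE.
by rewrite big_map big_enum.
Qed.
(** The square root is not rational: with zero error, [level_poly pq 0] would vanish at as many grid
    points as its size. *)
Lemma sqrt_err_max_gt0 N pq : admissible N pq ->
  exists2 t, 0 <= t <= 1 & 0 < `|sqrt_err pq t|.
Proof.
move=> [_ [_ qn0]]; apply: contrapT => nex.
have h0 : level_poly pq 0 != 0 by apply: level_poly_neq0; rewrite qn0// ler01 lexx.
pose m := size (level_poly pq 0).
pose rs : seq R := [seq j%:R / m.+1%:R | j <- iota 0 m].
have m0 : 0 < m.+1%:R :> R by rewrite ltr0Sn.
have urs : uniq rs.
  rewrite map_inj_uniq ?iota_uniq// => i j /(mulIf (invr_neq0 (lt0r_neq0 m0))) /eqP.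
  by rewrite eqr_nat => /eqP.
have ars : all (root (level_poly pq 0)) rs.
  apply/allP => _ /mapP[j + ->]; rewrite mem_iota add0n => jm; apply/eqP.
  have j01 : 0 <= (j%:R / m.+1%:R : R) <= 1.
    by rewrite divr_ge0 ?(ltW m0)//= ler_pdivrMr// mul1r ler_nat leqW// ltnW.
  rewrite level_poly_err ?qn0 ?sqr_itv// subr0.
  have /eqP -> : sqrt_err pq (j%:R / m.+1%:R) == 0; last by rewrite mulr0.
  by apply/negPn/negP; rewrite -normr_gt0 => hp; apply: nex; exists (j%:R / m.+1%:R).
by have := max_poly_roots h0 ars urs; rewrite size_map size_iota ltnn.
Qed.

Lemma best_err_le1 N pq E : best_approx N pq ->
  (exists2 t, 0 <= t <= 1 & `|sqrt_err pq t| = E) -> E <= 1.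
Proof.
move=> [_ [_ best]] [t t01 <-].
pose pq' : {poly R} * {poly R} := (0, 1).
have : err_le pq 1.
  apply: (best pq'); first split; [|split|] => /=.
  - by rewrite /deg_le size_poly0.
  - by rewrite /deg_le size_poly1.
  - by move=> x _; rewrite hornerC oner_neq0.
  - apply/err_leP => x /andP[x0 x1].
    by rewrite /sqrt_err/= horner0 mul0r subr0 ger0_norm.
by move/err_leP; apply.
Qed.

(** Here [A] and [B] stand for the products of [z - t_i] and [z + t_i], and [l] for a leading
    coefficient. From [e / (2 z - e) = A / B] and [|A| <= B] follows [e <= z], that is, the
    approximant is nonnegative. *)
Lemma err_le_id (z e q l A B : R) : 0 < z -> q != 0 -> l != 0 ->
  l * A = q * e -> l * B = q * (2 * z - e) -> `|A| <= B -> 0 < B -> e <= z.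
Proof.
move=> z0 q0 l0 e1 e2; rewrite ler_norml => /andP[A1 A2] B0.
have e3 : q * (2 * z) = l * (A + B) by rewrite [RHS]mulrDr e1 e2; ring.
have e4 : q * (z - e) * 2 = l * (B - A) by rewrite [RHS]mulrBr e1 e2; ring.
have AB : 0 < A + B.
  rewrite lt_neqAle; apply/andP; split; last by lra.
  apply: contra_neq q0 => /esym AB; move: e3; rewrite AB mulr0 => /eqP.
  by rewrite !mulf_eq0 pnatr_eq0 (gt_eqF z0)/= orbF => /eqP.
rewrite -subr_ge0.
have h5 : (z - e) * 2 * (A + B) = (2 * z) * (B - A).
  apply: (mulfI (mulf_neq0 q0 l0)).
  transitivity (q * (z - e) * 2 * (l * (A + B))); first by ring.
  by rewrite -e3 e4; ring.
have : 0 <= (z - e) * 2 * (A + B) by rewrite h5 mulr_ge0//; lra.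
by rewrite pmulr_lge0// pmulr_lge0.
Qed.

Lemma best_structure N pq : best_approx N pq ->
  exists (E : R) (a : nat -> R) (t : R -> 'I_(N.*2.+1) -> R),
  [/\ oscillating E (sqrt_err pq) a t,
      forall i : 'I_(N.*2.+1), (1 < i)%N -> E <= t 0 i,
      size pq.2 = N.+1 &
      level_poly pq 0 = lead_coef (level_poly pq 0) *:
        \prod_(i < N.*2.+1) ('X - (t 0 i)%:P)].
Proof.
move=> best; have [ad [cop _]] := best; have [sp [sq qn0]] := ad.
rewrite /deg_le in sp sq.
have [tm [tm01 _ tmax]] := sqrt_err_max ad.
set E := `|sqrt_err pq tm| in tmax.
have E0 : 0 < E.
  by have [x x01 px] := sqrt_err_max_gt0 ad; exact: lt_le_trans (tmax x x01).
have attained : exists2 t, 0 <= t <= 1 & `|sqrt_err pq t| = E by exists tm.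
have E1 : E <= 1 by exact: best_err_le1 best attained.
have ce t : 0 <= t <= 1 -> {for t, continuous (sqrt_err pq)}.
  exact: continuous_sqrt_err ad.
have q01 : pq.2.[1] != 0 by rewrite qn0// ler01 lexx.
have [D sD] : exists D, maxn (size pq.1) (size pq.2) = D.+1.
  have : (0 < maxn (size pq.1) (size pq.2))%N.
    rewrite leq_max size_poly_gt0 size_poly_gt0 orbC; apply/orP; left.
    by apply: contraNneq q01 => ->; rewrite horner0.
  by case: (maxn _ _) => // D _; exists D.
have DN : (D <= N)%N by rewrite -ltnS -sD geq_max sp.
have spD : (size pq.1 <= D.+1)%N by rewrite -sD leq_maxl.
have sqD : (size pq.2 <= D.+1)%N by rewrite -sD leq_maxr.
have [[a alt ak1]|[s ss hs]] := alternation_or_separation (N + D) E0 ce; last first.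
  by case: (best_no_separation best E0 tmax attained sD ss hs).
have roots g : -E < g < E -> exists t : 'I_(N + D).+1 -> R,
    forall i : 'I_(N + D).+1, a i < t i < a i.+1 /\ root (level_poly pq g) (t i).
  move=> gE; have [t ht] := choice (alternates_level alt ak1 ce gE).
  exists t => i; have [ti ei] := ht i; split => //; apply/eqP.
  have /andP[l1 l2] := ti.
  rewrite level_poly_err; first by rewrite ei subrr mulr0.
  apply: qn0; apply: sqr_itv.
  rewrite (le_trans (alternates_ge0 alt (ltnW (ltn_ord i))) (ltW l1))/=.
  rewrite (le_trans (ltW l2))// (le_trans _ ak1)//.
  by apply: (alternates_le alt); rewrite leqnn andbT.
have h0 g : level_poly pq g != 0 by exact: level_poly_neq0.
(* The [N + D + 1] roots found cannot exceed the degree [2 D + 1]; hence [N <= D], and every root of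
   a level polynomial is one of the located points. *)
have ND : N = D.
  have [|t ht] := roots 0; first by rewrite oppr_lt0 E0.
  have [+ _] := ordered_roots_prod (h0 0) ht.
  move=> /leq_trans/(_ (size_level_poly 0 spD sqD)); lia.
subst D.
have kN : (N + N).+1 = N.*2.+1 by rewrite addnn.
move: a alt ak1 roots; rewrite kN => a alt ak1 roots.
have roots' g : exists t : 'I_(N.*2.+1) -> R, -E < g * E < E ->
    forall i : 'I_(N.*2.+1), a i < t i < a i.+1 /\ root (level_poly pq (g * E)) (t i).
  have [gE|gE] := boolP (-E < g * E < E).
    by have [t ht] := roots (g * E) gE; exists t.
  by exists (fun=> 0).
have [t ht] := choice roots'.
have cE c : -1 < c < 1 -> -E < c * E < E by move=> /andP[? ?]; nra.
have szl g : -E < g < E -> size (level_poly pq g) = N.*2.+2.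
  move=> gE; have [t' ht'] := roots g gE; apply/eqP; rewrite eqn_leq.
  by rewrite size_level_poly//; have [-> _] := ordered_roots_prod (h0 g) ht'.
have prodE c : -1 < c < 1 -> level_poly pq (c * E) =
    lead_coef (level_poly pq (c * E)) *: \prod_(i < N.*2.+1) ('X - (t c i)%:P).
  move=> c1; have [_] := ordered_roots_prod (h0 (c * E)) (ht c (cE c c1)).
  by apply; apply: szl; exact: cE.
have prodz c z : -1 < c < 1 -> (level_poly pq (c * E)).[z] =
    lead_coef (level_poly pq (c * E)) * \prod_(i < N.*2.+1) (z - t c i).
  move=> c1; rewrite {1}(prodE c c1) hornerZ horner_prod; congr (_ * _).
  by apply: eq_bigr => i _; rewrite hornerXsubC.
have prodNz c z : -1 < c < 1 -> (level_poly pq (c * E)).[- z] =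
    - (lead_coef (level_poly pq (c * E)) * \prod_(i < N.*2.+1) (z + t c i)).
  move=> c1; rewrite prodz// -mulrN; congr (_ * _).
  transitivity (\prod_(i < N.*2.+1) (- (z + t c i))).
    by apply: eq_bigr => i _; rewrite opprD.
  by rewrite prodrN card_ord -signr_odd/= odd_double/= mulN1r.
have lc0 c : lead_coef (level_poly pq (c * E)) != 0 by rewrite lead_coef_eq0.
have c0 : -1 < (0 : R) < 1 by rewrite ltrN10 ltr01.
have osc : oscillating E (sqrt_err pq) a t.
  split => //.
  - by case: alt.
  - by move=> c i c1; have [] := ht c (cE c c1) i.
  - move=> c z c1 z01; have qz := qn0 _ (sqr_itv z01).
    have e1 := level_poly_err (c * E) qz; have e2 := level_polyN_err (c * E) qz.
    rewrite prodz// in e1; rewrite prodNz// in e2.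
    move: (lead_coef _) (lc0 c) e1 (oppr_inj e2) => l l0 e1' e2'.
    by apply: (mulfI (mulf_neq0 l0 qz)); rewrite [LHS]mulrACA [RHS]mulrACA e1' e2'; ring.
exists E, a, t; split => //.
- have rge0 z : 0 < z <= 1 -> sqrt_err pq z <= z.
    move=> /andP[z0 z1]; have z01 : 0 <= z <= 1 by rewrite ltW.
    have qz := qn0 _ (sqr_itv z01).
    have e1 := level_poly_err (0 * E) qz; have e2 := level_polyN_err (0 * E) qz.
    rewrite prodz// in e1; rewrite prodNz// in e2.
    have {}e2 := oppr_inj e2.
    have le : `|\prod_(i < N.*2.+1) (z - t 0 i)| <= \prod_(i < N.*2.+1) (z + t 0 i).
      rewrite normr_prod; apply: ler_prod => i _; rewrite normr_ge0/=.
      by have /andP[? ?] := osc_t_itv osc i c0; rewrite ler_norml; lra.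
    have pp : 0 < \prod_(i < N.*2.+1) (z + t 0 i).
      by apply: prodr_gt0 => i _; have /andP[? ?] := osc_t_itv osc i c0; lra.
    apply: (err_le_id z0 qz (lc0 0) _ _ le pp); first by rewrite e1 mul0r subr0.
    by rewrite e2 mul0r addr0.
  (* One of [a 1], [a 2] has error exactly [E], so [rge0] puts that point, and with it every [t 0 i]
     with [i >= 2], at or above [E]. The point [a 0] may be 0, where [rge0] says nothing. *)
  move=> i i1; have [_ _ halt] := alt.
  have /andP[ti _] := osc_itv osc i c0.
  have n2 : (2 <= N.*2.+1)%N by rewrite (leq_trans i1)// ltnW.
  have [l1 f1] := halt 0%N (ltnW n2); have [l2 f2] := halt 1%N n2.
  have a0 := osc_a0 osc.
  have ai j : (j <= 2)%N -> a j <= t 0 i.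
    move=> j2; rewrite (le_trans _ (ltW ti))//; apply: (alternates_le alt).
    by rewrite (leq_trans j2)//= ltnW.
  have aj j : (0 < j <= 2)%N -> 0 < a j <= 1.
    move=> /andP[j0 j2]; apply/andP; split; last first.
      by rewrite (le_trans (ai j j2))//; have /andP[_ /ltW] := osc_t_itv osc i c0.
    rewrite (lt_le_trans (y := a 1%N)) ?(le_lt_trans a0)//.
    by apply: (alternates_le alt); rewrite j0 (leq_trans j2).
  have n1 := alternates_norm alt (leq_trans (isT : 1 <= 2)%N n2).
  have := rge0 _ (aj 1%N isT); have := rge0 _ (aj 2%N isT).
  have := ai 1%N isT; have := ai 2%N isT; rewrite f2.
  by move: n1; case: (ger0P (sqrt_err pq (a 1%N))) => _; lra.
- apply/eqP; rewrite eqn_leq sq/= ltnNge; apply/negP => sq'.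
  have := size_level_poly_lt 0 sp sq'; rewrite szl ?ltnn//.
  by rewrite oppr_lt0 E0.
- by have := prodE 0 c0; rewrite mul0r.
Qed.

End Structure.

(** * Poles as solutions of an arctangent equation *)

Section Poles.
Context {R : realType}.
Local Open Scope complex_scope.
Implicit Types (v y x : R).

Lemma polar_factor x y : 0 < y -> exists2 r : R, 0 < r &
  Complex (- x) y = (Complex 0 1) * r%:C *
    Complex (cos (atan (x / y))) (sin (atan (x / y))) :> R[i].
Proof.
move=> y0; set th := atan (x / y).
have c0 : 0 < cos th by rewrite cos_atan invr_gt0 sqrtr_gt0 ltr_pwDl// sqr_ge0.
have tn : tan th = x / y by rewrite atanK.
have st : sin th = x / y * cos th by rewrite -tn /tan mulfVK// gt_eqF.
exists (y / cos th); first by rewrite divr_gt0.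
apply/eqP; rewrite eq_complex /= st !mul0r !mul1r.
rewrite !(sub0r, add0r, addr0, subr0, mul0r, oppr0, mulr0).
by apply/andP; split; apply/eqP; field; rewrite ?gt_eqF.
Qed.

Lemma polar_prod n (t : 'I_n -> R) y : 0 < y -> exists2 r : R, 0 < r &
  \prod_(i < n) Complex (- t i) y = (Complex 0 1) ^+ n * r%:C *
    Complex (cos (\sum_(i < n) atan (t i / y))) (sin (\sum_(i < n) atan (t i / y))) :> R[i].
Proof.
move=> y0; elim: n t => [|n IH] t.
  by exists 1 => //; rewrite !big_ord0 cos0 sin0 expr0 !mul1r.
have [r r0 e] := IH (fun i => t (widen_ord (leqnSn n) i)).
have [r' r'0 e'] := polar_factor (t ord_max) y0.
exists (r * r'); first by rewrite mulr_gt0.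
rewrite !big_ord_recr/= e e' cosD sinD exprSr rmorphM/=.
set S := \sum_(i < n) _; set th := atan _.
have -> : Complex (cos S * cos th - sin S * sin th) (sin S * cos th + cos S * sin th) =
   Complex (cos S) (sin S) * Complex (cos th) (sin th) :> R[i].
  by apply/eqP; rewrite eq_complex /= eqxx/=; apply/eqP; ring.
ring.
Qed.

(** At [i y] the level polynomial is [i y q(- y^2) - p(- y^2)], with imaginary part [y q(- y^2)]. In
    the factored form, [i ^ (2 N + 1)] is [i] up to sign, so this imaginary part is a multiple of
    the cosine. *)
Lemma pole_of_cos_eq0 N (pq : {poly R} * {poly R}) (t : 'I_(N.*2.+1) -> R) y :
  level_poly pq 0 = lead_coef (level_poly pq 0) *: \prod_(i < N.*2.+1) ('X - (t i)%:P) ->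
  0 < y -> cos (\sum_(i < N.*2.+1) atan (t i / y)) = 0 ->
  pq.2.[- y ^+ 2] = 0.
Proof.
move=> hE y0 c0.
pose w : R[i] := Complex 0 y.
have w2 : w ^+ 2 = real_complex R (- y ^+ 2).
  by apply/eqP; rewrite expr2 eq_complex /= !(mul0r, mulr0, sub0r, addr0) expr2 !eqxx.
have lhs : (map_poly (real_complex R) (level_poly pq 0)).[w] =
    w * real_complex R pq.2.[- y ^+ 2] - real_complex R pq.1.[- y ^+ 2].
  rewrite /level_poly scale0r subr0 rmorphB rmorphM/= !map_comp_poly/= map_polyXn map_polyX.
  by rewrite !hornerE !horner_comp !hornerE w2 !horner_map.
have [r r0 pE] := polar_prod t y0.
have rhs : (map_poly (real_complex R) (level_poly pq 0)).[w] =
    real_complex R (lead_coef (level_poly pq 0)) * \prod_(i < N.*2.+1) Complex (- t i) y.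
  rewrite {1}hE map_polyZ hornerZ rmorph_prod horner_prod; congr (_ * _).
  apply: eq_bigr => i _; rewrite rmorphB/= map_polyX map_polyC/= hornerXsubC.
  by apply/eqP; rewrite eq_complex /= sub0r oppr0 addr0 !eqxx.
move: rhs; rewrite lhs pE c0.
have -> : (Complex 0 1 : R[i]) ^+ N.*2.+1 = real_complex R ((-1) ^+ N) * Complex 0 1.
  rewrite exprSr -muln2 mulnC exprM; congr (_ * _).
  by rewrite rmorphXn/= rmorphN1 sqr_i.
move: (lead_coef _) (sin _) ((-1) ^+ N) => l s m /eqP; rewrite eq_complex /=.
move=> /andP[_ /eqP]; rewrite !(mul0r, mulr0, mul1r, mulr1, sub0r, addr0, add0r, subr0, oppr0).
by move/eqP; rewrite mulf_eq0 (gt_eqF y0) => /eqP.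
Qed.

Lemma sum_atan_mono n (t : 'I_n -> R) v v' : (forall i, 0 < t i) -> v <= v' ->
  \sum_(i < n) atan (t i * v) <= \sum_(i < n) atan (t i * v').
Proof. by move=> t0 vv; apply: ler_sum => i _; apply: le_atan; rewrite ler_pM2l. Qed.

Lemma sum_atan_solve N (t : 'I_(N.*2.+1) -> R) k : (forall i, 0 < t i) -> (k < N)%N ->
  exists2 v, 0 < v & \sum_(i < N.*2.+1) atan (t i * v) = (2 * k%:R + 1) * (pi / 2).
Proof.
move=> t0 kN; set S := fun v => \sum_(i < N.*2.+1) atan (t i * v).
have p2 : 0 < pi / 2 :> R by rewrite divr_gt0// pi_gt0.
(* If every [atan (t i * V)] reaches [th], their sum reaches [2 N pi / 2], above all the targets
   [(2 k + 1) pi / 2] with [k < N]. *)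
pose th : R := N.*2%:R / N.*2.+1%:R * (pi / 2).
have n0 : 0 < N.*2.+1%:R :> R by rewrite ltr0n.
have th0 : 0 <= th by rewrite mulr_ge0 ?(ltW p2)// divr_ge0.
have th1 : th < pi / 2 by rewrite gtr_pMl// ltr_pdivrMr// mul1r ltr_nat.
have tth0 : 0 <= tan th.
  by rewrite /tan divr_ge0 ?sin_ge0_pi ?cos_ge0_pihalf//; lra.
(* A sum of nonnegative terms dominates each of them, and so serves as their maximum. *)
pose V := \sum_(i < N.*2.+1) tan th / t i.
have V0 : 0 <= V by apply: sumr_ge0 => i _; rewrite divr_ge0// ltW.
have SV : N.*2%:R * (pi / 2) <= S V.
  have -> : N.*2%:R * (pi / 2) = \sum_(i < N.*2.+1) th.
    by rewrite sumr_const card_ord -mulr_natl /th; field; rewrite gt_eqF.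
  apply: ler_sum => i _; rewrite -[th]tanK; last by rewrite in_itv/=; lra.
  apply: le_atan; rewrite mulrC -ler_pdivrMr// /V (bigD1 i)//= lerDl.
  by apply: sumr_ge0 => j _; rewrite divr_ge0// ltW.
have cS : {within `[0, V], continuous S}.
  apply: within_continuous_itv => v _; apply: cont_sum => i.
  apply: (@cont_comp _ (fun v => t i * v)); last exact: continuous_atan.
  by apply: contZ; exact: cont_id.
have S0 : S 0 = 0 by rewrite /S big1// => i _; rewrite mulr0 atan0.
have k0 : 0 < (2 * k%:R + 1) * (pi / 2) :> R by rewrite mulr_gt0// ltr_wpDl// mulr_ge0.
have [|v] := IVT V0 cS (v := (2 * k%:R + 1) * (pi / 2)).
  rewrite S0 ge_min (ltW k0)/= le_max; apply/orP; right; apply: le_trans SV.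
  rewrite ler_pM2r// -natrM natr1 ler_nat -muln2 mulnC.
  by rewrite (leq_trans (_ : _ <= k.+1 * 2)%N) ?leq_mul2r//; lia.
rewrite in_itv/= => /andP[v0 _] Sv; exists v => //.
rewrite lt_neqAle v0 andbT; apply: contraTneq k0 => v00.
by rewrite -Sv -v00 S0 ltxx.
Qed.
Lemma cos_odd_pihalf k : cos ((2 * k%:R + 1) * (pi / 2)) = 0 :> R.
Proof.
elim: k => [|k IH]; first by rewrite mulr0 add0r mul1r cos_pihalf.
have -> : (2 * k.+1%:R + 1) * (pi / 2) = (2 * k%:R + 1) * (pi / 2) + pi :> R.
  by rewrite -(natr1 k); field.
by rewrite cosDpi IH oppr0.
Qed.

(** The [N] targets give [N] distinct roots of [q], hence all of them. As [v] increases with [k],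
    the moduli decrease, so the sorted list is the reverse enumeration. *)
Lemma poles_formula N (pq : {poly R} * {poly R}) (s : seq R[i]) (t : 'I_(N.*2.+1) -> R) :
  (forall i, 0 < t i) -> size pq.2 = N.+1 ->
  level_poly pq 0 = lead_coef (level_poly pq 0) *: \prod_(i < N.*2.+1) ('X - (t i)%:P) ->
  root_list pq.2 s -> sorted_by_abs s -> forall k, (k < N)%N ->
  exists v, [/\ 0 < v, \sum_(i < N.*2.+1) atan (t i * v) = (2 * k%:R + 1) * (pi / 2) &
    nth 0 s (N - k.+1) = (- (v^-1) ^+ 2)%:C].
Proof.
move=> t0 sq hE rl so.
have sol k : exists v, (k < N)%N -> 0 < v /\
    \sum_(i < N.*2.+1) atan (t i * v) = (2 * k%:R + 1) * (pi / 2).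
  have [kN|kN] := ltnP k N; last by exists 0.
  by have [v v0 e] := sum_atan_solve t0 kN; exists v.
have [v hv] := choice sol.
have p2 : 0 < pi / 2 :> R by rewrite divr_gt0// pi_gt0.
have vlt k l : (k < l < N)%N -> v k < v l.
  move=> /andP[kl lN]; rewrite ltNge; apply/negP => h.
  have [_ ek] := hv k (ltn_trans kl lN); have [_ el] := hv l lN.
  have := sum_atan_mono t0 h; rewrite ek el ler_pM2r// lerD2r ler_pM2l// ler_nat.
  by rewrite leqNgt kl.
pose x k : R := - ((v k)^-1) ^+ 2.
have xlt k l : (k < l < N)%N -> x k < x l.
  move=> h; have /andP[kl lN] := h; have [vk _] := hv k (ltn_trans kl lN); have [vl _] := hv l lN.
  rewrite ltrN2 ltr_pXn2r ?nnegrE ?invr_ge0 ?(ltW vk) ?(ltW vl)//.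
  by rewrite ltf_pV2 ?posrE// vlt.
have xroot k : (k < N)%N -> root pq.2 (x k).
  move=> kN; have [vk ek] := hv k kN; apply/eqP.
  apply: (pole_of_cos_eq0 hE); first by rewrite invr_gt0.
  under eq_bigr do rewrite invrK.
  by rewrite ek cos_odd_pihalf.
pose xs := [seq x k | k <- iota 0 N].
have uxs : uniq xs.
  rewrite map_inj_in_uniq ?iota_uniq// => k l; rewrite !mem_iota !add0n /= => kN lN e.
  apply/eqP; case: (ltngtP k l) => // h.
    by have := xlt k l; rewrite h lN e ltxx => /(_ isT).
  by have := xlt l k; rewrite h kN e ltxx => /(_ isT).
have axs : all (root pq.2) xs.
  by apply/allP => _ /mapP[k + ->]; rewrite mem_iota add0n /= => /xroot.
have sxs : size xs = N by rewrite size_map size_iota.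
have qE : pq.2 = lead_coef pq.2 *: \prod_(z <- xs) ('X - z%:P).
  by apply: all_roots_prod_XsubC; rewrite ?uniq_rootsE// sq sxs.
have lc0 : (lead_coef pq.2)%:C != 0 :> R[i].
  rewrite -(rmorph0 (real_complex R)) (inj_eq (@complexI _)) lead_coef_eq0.
  by rewrite -size_poly_gt0 sq.
pose zs := [seq (real_complex R z) | z <- xs].
have pe : perm_eq s zs.
  apply: prod_XsubC_eq; apply: (scalerI lc0); rewrite -[LHS]rl.
  rewrite {1}qE map_polyZ rmorph_prod /zs big_map [in RHS]big_map big_map; congr (_ *: _).
  by apply: eq_bigr => z _; rewrite rmorphB/= map_polyX map_polyC.
have nx k : `|real_complex R (x k)| = ((v k)^-1 ^+ 2)%:C :> R[i].
  rewrite normc_def/= expr0n addr0 sqrtr_sqr /x normrN ger0_norm// sqr_ge0//.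
(* Comparing moduli is antisymmetric only on these roots, which are all negative reals; this is what
   makes the sorted list unique. *)
have ss : s = rev zs.
  apply: (@sorted_eq_in _ (fun a b : R[i] => `|a| <= `|b|)) => //.
  - by move=> a b c _ _ _ /= h1 h2; exact: le_trans h2.
  - move=> a b; rewrite !(perm_mem pe) => /mapP[_ /mapP[k + ->] ->] /mapP[_ /mapP[l + ->] ->].
    rewrite !mem_iota !add0n /= => kN lN /andP[]; rewrite !nx !lecR => h1 h2.
    by rewrite /x; congr (- _)%:C; apply/le_anti; rewrite h1.
  - rewrite rev_sorted /zs /xs -map_comp.
    rewrite sorted_map.
    apply: (@sub_in_sorted _ [pred k | k < N]%N ltn); last exact: iota_ltn_sorted.
      move=> k l /= kN lN kl; rewrite !inE in kN lN *; rewrite /= !nx lecR.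
      by have := xlt k l; rewrite kl lN => /(_ isT); rewrite ltrN2; exact: ltW.
    by apply/allP => k; rewrite mem_iota add0n.
  - by rewrite perm_sym perm_rev perm_sym.
move=> k kN; have [vk ek] := hv k kN; exists (v k); split => //.
have szs : size zs = N by rewrite size_map.
rewrite ss nth_rev ?szs; last by rewrite ltn_subrL/= (leq_ltn_trans _ kN).
have -> : (N - (N - k.+1).+1 = k)%N by lia.
rewrite (nth_map 0) ?sxs// (nth_map 0%N) ?size_iota// nth_iota//.
Qed.

End Poles.

(** * Elimination of [L] and the limit *)

Section Limit.
Context {R : realType}.
Implicit Types (T L v w : R).

Lemma atan_ge_div v : 0 <= v -> v / (1 + v ^+ 2) <= atan v.
Proof.
move=> v0; rewrite -subr_ge0.
have {1}<- : atan 0 - 0 / (1 + 0 ^+ 2) = 0 :> R by rewrite atan0 mul0r subr0.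
have p (y : R) : 0 < 1 + y ^+ 2 by rewrite ltr_pwDl// sqr_ge0.
have pn (y : R) : 1 + y ^+ 2 != 0 by rewrite gt_eqF.
apply: (@le_derive_off_finite _ [::] (fun y => atan y - y / (1 + y ^+ 2))
  (fun y => 1 / (1 + y ^+ 2) - (1 * (1 + y ^+ 2) - y * (0 + 2 * y * 1)) / (1 + y ^+ 2) ^+ 2)) => //.
- apply: within_continuous_itv => x _; apply: contB; first exact: continuous_atan.
  apply: cont_div; [exact: pn|exact: cont_id|].
  by apply: contD; [exact: cont_cst|exact: exprn_continuous].
- move=> x _ _; have i := is_derive1_id x.
  exact: (is_derive1B (is_derive1_atan_chain i)
    (is_derive1_div i (is_derive1D (is_derive1_const 1 x) (is_derive1_sqr i)) (pn x))).
- move=> x _ _.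
  have -> : 1 / (1 + x ^+ 2) - (1 * (1 + x ^+ 2) - x * (0 + 2 * x * 1)) / (1 + x ^+ 2) ^+ 2
     = 2 * x ^+ 2 / (1 + x ^+ 2) ^+ 2 by field.
  by rewrite divr_ge0 ?sqr_ge0// mulr_ge0 ?sqr_ge0//.
Qed.

(** Here [w] is [sqrt N]. Squaring [pi T = L + O(1)] and comparing with [n pi^2 = L^2 + O(L)]
    eliminates [L], which is O(w). *)
Lemma sqr_sum_asymptotics T L w : 200 <= w -> 0 <= T -> 0 <= L ->
  `|pi * T - L| <= 15 ->
  `|(2 * w ^+ 2 + 1) * pi ^+ 2 - L ^+ 2| <= 32 * L + 200 ->
  `|T ^+ 2 - 2 * w ^+ 2| <= 127 * w.
Proof.
move=> w200 T0 L0; rewrite !ler_norml => /andP[h1 h2] /andP[h3 h4].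
have p2 := pi_ge2 R; have p4 : pi <= 4 :> R by have := pihalf_lt2 R; lra.
have pp4 : 4 <= pi ^+ 2 :> R by nra.
have pp16 : pi ^+ 2 <= 16 :> R by nra.
have w2 : 200 * w <= w ^+ 2 by rewrite expr2 ler_wpM2r//; lra.
have Lw : L <= 8 * w.
  rewrite leNgt; apply/negP => Lw.
  have a1 : (2 * w ^+ 2 + 1) * pi ^+ 2 <= (2 * w ^+ 2 + 1) * 16 by rewrite ler_wpM2l//; lra.
  have a2 : 8 * w * L <= L * L by rewrite ler_wpM2r// ltW.
  have a3 : 8 * w * (8 * w) <= 8 * w * L by rewrite ler_wpM2l ?(ltW Lw)//; lra.
  have a4 : 8 * 200 * L <= 8 * w * L by rewrite ler_wpM2r//; lra.
  move: a1 a2 a3 a4 h3; rewrite !expr2; lra.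
have pT0 : 0 <= pi * T by rewrite mulr_ge0// pi_ge0.
have b1 : (pi * T - L) * (pi * T + L) <= 15 * (pi * T + L) by rewrite ler_wpM2r//; lra.
have b2 : - 15 * (pi * T + L) <= (pi * T - L) * (pi * T + L) by rewrite ler_wpM2r//; lra.
have e : (pi * T - L) * (pi * T + L) = pi ^+ 2 * T ^+ 2 - L ^+ 2 by ring.
rewrite e in b1 b2.
(* The errors add up to at most [(30 L + 225) + (32 L + 200)], and [L <= 8 w]; the term 425 is
   absorbed by [w >= 200]. *)
have c1 : pi ^+ 2 * (T ^+ 2 - (2 * w ^+ 2 + 1)) <= 501 * w by lra.
have c2 : - (501 * w) <= pi ^+ 2 * (T ^+ 2 - (2 * w ^+ 2 + 1)) by lra.
have -> : T ^+ 2 - 2 * w ^+ 2 = T ^+ 2 - (2 * w ^+ 2 + 1) + 1 by ring.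
move: (T ^+ 2 - (2 * w ^+ 2 + 1)) c1 c2 => D c1 c2.
have d1 : D <= 126 * w.
  rewrite leNgt; apply/negP => h.
  have : 4 * D <= pi ^+ 2 * D by rewrite ler_wpM2r//; lra.
  by lra.
have d2 : - (126 * w) <= D.
  rewrite leNgt; apply/negP => h.
  have : 4 * - D <= pi ^+ 2 * - D by rewrite ler_wpM2r//; lra.
  by lra.
by apply/andP; split; lra.
Qed.

(** The ratio is [(th / v)^2 * (T^2 / (2 w^2))] with [th = ka / T]. The second factor is
    [1 + O(1 / w)]; since [atan v <= th <= v], the first is [1 + O(th^2)] with [th <= ka / w]. *)
Lemma ratio_bound (ka T v w : R) : 200 <= w -> 2 * ka <= w -> 0 < ka -> 0 < v -> 0 < T ->
  `|T ^+ 2 - 2 * w ^+ 2| <= 127 * w -> T * atan v <= ka -> ka <= T * v ->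
  `|ka ^+ 2 / (2 * w ^+ 2 * v ^+ 2) - 1| <= (64 + 16 * ka ^+ 2) / w.
Proof.
move=> w200 kw k0 v0 T0 hT hA hv.
have w0 : 0 < w by lra.
have w2 : 200 * w <= w ^+ 2 by rewrite expr2 ler_wpM2r//; lra.
move: hT; rewrite ler_norml => /andP[t1 t2].
have Tw : w <= T by rewrite -(@ler_pXn2r _ 2)// ?nnegrE ?(ltW w0) ?(ltW T0)//; lra.
pose th := ka / T.
have th0 : 0 < th by rewrite divr_gt0.
have thw : th <= ka / w by rewrite ler_pM2l// lef_pV2.
have kw2 : ka / w <= 2^-1 by rewrite ler_pdivrMr//; lra.
have A1 : atan v <= th by rewrite /th ler_pdivlMr// mulrC.
have A2 : th <= v by rewrite /th ler_pdivrMr// mulrC.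
(* Otherwise [atan v] would exceed [pi / 4 >= 1 / 2], while [atan v <= th <= 1 / 2]. *)
have v1 : v <= 1.
  rewrite leNgt; apply/negP => h; have := lt_atan h; rewrite atan1.
  by have := pi_ge2 R; lra.
have q0 : 0 < 1 + v ^+ 2 by rewrite ltr_pwDl// sqr_ge0.
have A3 : v <= th * (1 + v ^+ 2).
  by rewrite -ler_pdivrMr// (le_trans (atan_ge_div (ltW v0))).
have v2 : v ^+ 2 <= 1 by rewrite exprn_ile1// ltW.
have A4 : v <= 2 * th by nra.
have A5 : v ^+ 2 <= 4 * th ^+ 2 by have := ler_pM (ltW v0) (ltW v0) A4 A4; rewrite !expr2; lra.
pose x := th / v.
have x0 : 0 < x by rewrite divr_gt0.
have x1 : x <= 1 by rewrite ler_pdivrMr// mul1r.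
have x2 : 1 <= x * (1 + 4 * th ^+ 2).
  rewrite /x mulrAC ler_pdivlMr// mul1r (le_trans A3)// ler_wpM2l ?(ltW th0)//; lra.
have x3 : 1 - 4 * th ^+ 2 <= x by have := sqr_ge0 th; nra.
have x4 : 1 - 8 * th ^+ 2 <= x ^+ 2 by have := sqr_ge0 (1 - x); rewrite !expr2 in x3 *; lra.
have x5 : x ^+ 2 <= 1 by rewrite exprn_ile1// ltW.
have thk : th ^+ 2 <= ka ^+ 2 / w ^+ 2.
  by rewrite -expr_div_n ler_pXn2r ?nnegrE ?(ltW th0)// divr_ge0// ltW.
pose Y := T ^+ 2 / (2 * w ^+ 2).
have ww0 : 0 < 2 * w ^+ 2 by rewrite mulr_gt0// exprn_gt0.
have Y1 : Y <= 1 + 64 / w.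
  rewrite ler_pdivrMr//.
  have -> : (1 + 64 / w) * (2 * w ^+ 2) = 2 * w ^+ 2 + 128 * w by field; rewrite gt_eqF.
  lra.
have Y2 : 1 - 64 / w <= Y.
  rewrite ler_pdivlMr//.
  have -> : (1 - 64 / w) * (2 * w ^+ 2) = 2 * w ^+ 2 - 128 * w by field; rewrite gt_eqF.
  lra.
have w64 : 64 / w <= 1 by rewrite ler_pdivrMr//; lra.
have -> : ka ^+ 2 / (2 * w ^+ 2 * v ^+ 2) = x ^+ 2 * Y.
  by rewrite /x /Y /th; field; rewrite !gt_eqF.
have Y0 : 0 <= Y by lra.
have r1 : x ^+ 2 * Y <= Y by rewrite ler_piMl.
have r2 : (1 - 8 * th ^+ 2) * Y <= x ^+ 2 * Y by rewrite ler_wpM2r.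
have r3 : th ^+ 2 * Y <= th ^+ 2 * 2 by rewrite ler_wpM2l ?sqr_ge0//; lra.
have r4 : ka ^+ 2 / w ^+ 2 <= ka ^+ 2 / w.
  by rewrite ler_wpM2l ?sqr_ge0// lef_pV2 ?posrE ?exprn_gt0//; lra.
rewrite mulrDl -mulrA.
have r5 : 0 <= ka ^+ 2 / w by rewrite divr_ge0 ?sqr_ge0 ?ltW.
by rewrite ler_norml; apply/andP; split; lra.
Qed.
Lemma pole_ratio_bound N k (pq : {poly R} * {poly R}) (s : seq R[i]) :
  best_approx N pq -> root_list pq.2 s -> sorted_by_abs s -> (k < N)%N ->
  let ka : R := (2 * k%:R + 1) * (pi / 2) in
  200 <= Num.sqrt (N%:R : R) -> 2 * ka <= Num.sqrt N%:R ->
  exists2 rho : R, `|rho - 1| <= (64 + 16 * ka ^+ 2) / Num.sqrt N%:R &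
    nth 0 s (N - k.+1)%N /
      (real_complex R (- (8 * N%:R) / ((2 * k%:R + 1) ^+ 2 * pi ^+ 2))) =
    real_complex R rho.
Proof.
move=> best rl so kN ka; set w := Num.sqrt _ => w200 kw.
have [E [a [t [osc tE sq hE]]]] := best_structure best.
have c0 : -1 < (0 : R) < 1 by rewrite ltrN10 ltr01.
have t01 i : 0 < t 0 i < 1 by exact: osc_t_itv osc _ _ c0.
have t0 i : 0 < t 0 i by case/andP: (t01 i).
have [v [v0 Sv ->]] := poles_formula t0 sq hE rl so kN.
have w0 : 0 < w by lra.
have w2 : w ^+ 2 = N%:R by rewrite sqr_sqrtr.
have N0 : 0 < N%:R :> R by rewrite -w2 exprn_gt0.
have p0 := pi_gt0 R.
have k1 : 0 < 2 * k%:R + 1 :> R by rewrite ltr_wpDl// mulr_ge0.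
pose T := \sum_(i < N.*2.+1) t 0 i.
have T0 : 0 < T.
  rewrite /T big_ord_recl ltr_pwDl//.
  by apply: sumr_ge0 => i _; exact: ltW.
have L0 : 0 <= ln E^-1.
  by rewrite ln_ge0// invf_ge1 ?(osc_E_le1 osc)// (osc_E_gt0 osc).
exists (ka ^+ 2 / (2 * w ^+ 2 * v ^+ 2)).
  apply: (ratio_bound w200 kw _ v0 T0).
  - by rewrite mulr_gt0// divr_gt0.
  - apply: (sqr_sum_asymptotics w200 (ltW T0) L0 (osc_sum_t osc)).
    have -> : 2 * w ^+ 2 + 1 = N.*2.+1%:R :> R by rewrite w2 -mul2n -[in RHS]natr1 natrM.
    exact: osc_count osc tE.
  - rewrite -/ka in Sv; rewrite -Sv mulr_suml; apply: ler_sum => i _.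
    apply: atan_mul_ge; last exact: ltW.
    by have /andP[? ?] := t01 i; rewrite !ltW.
  - rewrite -/ka in Sv; rewrite -Sv mulr_suml; apply: ler_sum => i _; apply: atan_le.
    by rewrite mulr_ge0 ?(ltW v0)// ltW.
rewrite -fmorphV -rmorphM/=; congr (real_complex R _).
have alg (P K V M : R) : 0 < P -> 0 < K -> 0 < V -> 0 < M ->
    (- V^-1 ^+ 2) / (- (8 * M) / (K ^+ 2 * P ^+ 2)) = (K * (P / 2)) ^+ 2 / (2 * M * V ^+ 2).
  by move=> P0 K0 V0 M0; field; rewrite !gt_eqF.
by rewrite w2 /ka; exact: alg.
Qed.

Lemma cvg_of_rate (u : nat -> R) (l C : R) (N0 : nat) :
  (forall N, (N0 <= N)%N -> 200 <= Num.sqrt (N%:R : R) ->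
     C <= Num.sqrt N%:R -> `|u N - l| <= C / Num.sqrt N%:R) -> u @ \oo --> l.
Proof.
move=> h; apply/cvgrPdist_le => e e0; near=> N.
rewrite distrC.
have big (r : R) : r ^+ 2 <= N%:R -> r <= Num.sqrt N%:R.
  move=> rN; rewrite (le_trans (ler_norm r))// -sqrtr_sqr ler_sqrt//.
have h200 : 200 <= Num.sqrt (N%:R : R) by apply: big; near: N; exact: nbhs_infty_ger.
have hC : C <= Num.sqrt (N%:R : R) by apply: big; near: N; exact: nbhs_infty_ger.
have hCe : C / e <= Num.sqrt (N%:R : R) by apply: big; near: N; exact: nbhs_infty_ger.
apply: le_trans (h N _ h200 hC) _; first by near: N; exact: nbhs_infty_ge.
by rewrite ler_pdivrMr -?ler_pdivrMl// 1?mulrC//; lra.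
Unshelve. all: by end_near. Qed.

End Limit.
Local Open Scope complex_scope.
Local Open Scope classical_set_scope.

(* For any choice, for every N, of the degree-N best approximant (in lowest
   terms) and of an ordering p_{1,N},...,p_{N,N} of its poles by increasing
   absolute value, and for every fixed k, the pole p_{N-k,N} (= entry of
   0-based index N-k-1) satisfies p_{N-k,N} / (-(8N)/((2k+1)^2 pi^2)) -> 1
   as N -> oo (real part -> 1, imaginary part -> 0). *)
Theorem theorem2p4 (R : realType)
    (pq : nat -> {poly R} * {poly R}) (poles : nat -> seq R[i]) :
  (forall N : nat, best_approx N (pq N)) ->
  (forall N : nat, root_list (pq N).2 (poles N) /\ sorted_by_abs (poles N)) ->
  forall k : nat,
    let ratio := fun N : nat =>
      nth 0 (poles N) (N - k.+1)%N /
        (- (8 * N%:R) / ((2 * k%:R + 1) ^+ 2 * pi ^+ 2) : R)%:C in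
    ((fun N => complex.Re (ratio N)) @ \oo --> (1 : R)) /\
    ((fun N => complex.Im (ratio N)) @ \oo --> (0 : R)).
Proof.
move=> best rls k ratio.
pose ka : R := (2 * k%:R + 1) * (pi / 2).
pose C : R := 64 + 16 * ka ^+ 2.
(* From [2 ka <= 1 + ka^2]; thus [C] serves both as the rate constant and as the threshold on
   [sqrt N]. *)
have kC : 2 * ka <= C by have := sqr_ge0 (1 - ka); have := sqr_ge0 ka; rewrite /C; lra.
have C0 : 0 <= C by have := sqr_ge0 ka; rewrite /C; lra.
have key N : (k < N)%N -> 200 <= Num.sqrt (N%:R : R) -> C <= Num.sqrt N%:R ->
    exists2 rho : R, `|rho - 1| <= C / Num.sqrt N%:R & ratio N = rho%:C.
  move=> kN w200 Cw; have [rl so] := rls N.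
  by apply: pole_ratio_bound => //; exact: le_trans kC Cw.
split.
  apply: (@cvg_of_rate _ _ _ C k.+1) => N kN w200 Cw.
  by have [rho h ->] := key N kN w200 Cw.
apply: (@cvg_of_rate _ _ _ C k.+1) => N kN w200 Cw.
have [rho h ->] := key N kN w200 Cw.
by rewrite /= subrr normr0 divr_ge0// sqrtr_ge0.
Qed.
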